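(* (i) The space $\mathfrak{krv}_{ell}$ is bigraded for the weight and the depth. (ii) For each $b\in\mathfrak{krv}_{ell}$ there exists a unique $a\in\mathfrak{lie}_C$ (the partner of $b$) such that the derivation $D_{b,a}$ lies in $\mathfrak{oder}_2$. (iii) The image of the injective linear map $b\mapsto D_{b,a}$ is a Lie subalgebra of $\mathfrak{oder}_2$; equivalently, $\mathfrak{krv}_{ell}$ is a Lie algebra under the bracket $\langle b,b'\rangle=D_{b,a}(b')-D_{b',a'}(b)$, where $a,a'$ are the partners of $b,b'$.
   Context: Let $\mathfrak{lie}_2$ be the degree-completed free Lie algebra over $\mathbb{Q}$ on $x,y$ (weight = degree, depth = $y$-degree), $C_i=\mathrm{ad}(x)^{i-1}(y)$, and $\mathfrak{lie}_C$ the completed free Lie algebra on the $C_i$ inside $\mathfrak{lie}_2$. For $b,a\in\mathfrak{lie}_2$, $D_{b,a}$ is the derivation with $x\mapsto b$, $y\mapsto a$. $\mathfrak{oder}_2$ is the Lie algebra (under commutator) of derivations $D$ of $\mathfrak{lie}_2$ with $D([x,y])=0$ and such that neither $D(x)$ nor $D(y)$ has a linear term in $x$. Moulds: a mould is a family $A=(A^r)_{r\ge0}$ with $A^r\in\mathbb{Q}(u_1,\dots,u_r)$; $ARI$ is the space of moulds with $A^0=0$; $\overline{ARI}$ is the same in variables $v_1,v_2,\dots$. A constant-valued mould is one with each $A^r$ a constant. $swap:ARI\to\overline{ARI}$, $swap(A)(v_1,\dots,v_r)=A(v_r,v_{r-1}-v_r,\dots,v_1-v_2)$. $A\in ARI$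 is push-invariant if $A(u_0,u_1,\dots,u_{r-1})=A(u_1,\dots,u_r)$ for all $r\ge1$, with $u_0=-u_1-\dots-u_r$. $B\in\overline{ARI}$ is circ-neutral if $\sum_{i=0}^{r-1}B(v_{i+1},\dots,v_r,v_1,\dots,v_i)=0$ for all $r>1$. For $b\in\mathfrak{lie}_C$ write its depth-$r$ part uniquely as $\sum k_{\underline a}C_{a_1}\cdots C_{a_r}$ and set $B^r(u_1,\dots,u_r)=\sum k_{\underline a}u_1^{a_1-1}\cdots u_r^{a_r-1}$, $B_*^r=B^r/(u_1\cdots u_r(u_1+\dots+u_r))$, and $B_*=(B_*^r)_r\in ARI$. Then $\mathfrak{krv}_{ell}$ is the space of $b\in\mathfrak{lie}_C$ such that $B_*$ is push-invariant and there is a constant-valued mould $M_0$ with $swap(B_* )+M_0$ circ-neutral. *)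

(* Defs.v *)
From HB Require Import structures.
From mathcomp Require Import all_boot all_order all_algebra.
From mathcomp Require Import fraction generic_quotient.
From mathcomp.multinomials Require Import mpoly.

Set Implicit Arguments.
Unset Strict Implicit.
Unset Printing Implicit Defensive.

Import GRing.Theory.
Local Open Scope ring_scope.

(* The degree-completed free associative algebra Q<<x,y>>, in which the     *)
(* degree-completed free Lie algebra lie_2 sits.  A word is a seq bool,      *)
(* with false = x and true = y; a series is its coefficient function.       *)

Definition word := seq bool.
Definition series := word -> rat.

Definition szero : series := fun _ => 0.
Definition sadd (f g : series) : series := fun w => f w + g w.
Definition sscale (c : rat) (f : series) : series := fun w => c * f w.
Definition smul (f g : series) : series :=
  fun w => \sum_(i < (size w).+1) f (take i w) * g (drop i w).
Definition sbr (f g : series) : series := fun w => smul f g w - smul g f w.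
Definition mon (u : word) : series := fun w => (w == u)%:R.
Definition X : series := mon [:: false].
Definition Y : series := mon [:: true].

Definition depth (w : word) : nat := count id w.
Definition wt_part (n : nat) (f : series) : series :=
  fun w => if size w == n then f w else 0.
Definition dp_part (r : nat) (f : series) : series :=
  fun w => if depth w == r then f w else 0.

Inductive lie_span (S : series -> Prop) : series -> Prop :=
| ls_gen s : S s -> lie_span S s
| ls_zero : lie_span S szero
| ls_add f g : lie_span S f -> lie_span S g -> lie_span S (sadd f g)
| ls_scale c f : lie_span S f -> lie_span S (sscale c f)
| ls_br f g : lie_span S f -> lie_span S g -> lie_span S (sbr f g).

Definition lie2 (f : series) : Prop :=
  forall n, exists p, lie_span (fun s => s = X \/ s = Y) p /\
                      forall w, wt_part n f w = p w.

Definition Cgen (i : nat) : series := iter i.-1 (sbr X) Y.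

Definition lieC (f : series) : Prop :=
  forall n, exists p, lie_span (fun s => exists2 i, (0 < i)%N & s = Cgen i) p /\
                      forall w, wt_part n f w = p w.

(* The derivation D_{b,a} (x |-> b, y |-> a), extended continuously to      *)
(* Q<<x,y>> (it restricts to the derivation of lie_2).                      *)

(* coefficient of the word v in  u1 * g * u2 *)
Definition coef_mid (u1 u2 : word) (g : series) (v : word) : rat :=
  if (size u1 + size u2 <= size v)%N && (take (size u1) v == u1)
     && (drop (size v - size u2) v == u2)
  then g (take (size v - size u1 - size u2) (drop (size u1) v)) else 0.

Definition der_word (b a : series) (w : word) (v : word) : rat :=
  \sum_(i < size w)
     coef_mid (take i w) (drop i.+1 w) (if nth false w i then a else b) v.

(* D_{b,a}(f); only words of length <= |v| contribute since b, a have no   *)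
(* constant term (they lie in lie_2).                                        *)
Definition der (b a : series) (f : series) : series :=
  fun v => \sum_(n < (size v).+1) \sum_(w : n.-tuple bool) f w * der_word b a w v.

(* D_{b,a} lies in oder_2: it is a derivation of lie_2 (b, a in lie_2),     *)
(* D([x,y]) = [b,y] + [x,a] = 0, and neither D(x) = b nor D(y) = a has a    *)
(* linear term in x.                                                         *)
Definition in_oder2 (b a : series) : Prop :=
  [/\ lie2 b, lie2 a, b [:: false] = 0, a [:: false] = 0 &
      forall w, sadd (sbr b Y) (sbr X a) w = 0].

(* Moulds.  A^r lives in Q(u_1,..,u_r) = {fraction {mpoly rat[r]}}, the     *)
(* variable u_(j+1) (or v_(j+1)) being 'X_j.                                 *)

Definition ratfun (r : nat) := {fraction {mpoly rat[r]}}.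

Definition tofr (r : nat) (p : {mpoly rat[r]}) : ratfun r := @FracField.tofrac _ p.
Local Notation "x %:F" := (tofr x).

(* the (j+1)-th variable, j a nat (0 if out of range) *)
Definition Xv (r j : nat) : {mpoly rat[r]} := nth 0 [seq 'X_k | k <- enum 'I_r] j.

Definition fsub (r : nat) (lq : r.-tuple {mpoly rat[r]}) (f : ratfun r) : ratfun r :=
  let q := frac (repr f) in (comp_mpoly lq q.1)%:F / (comp_mpoly lq q.2)%:F.

(* A(u_0, u_1, ..., u_(r-1)) with u_0 = - u_1 - ... - u_r *)
Definition push_sub (r : nat) : r.-tuple {mpoly rat[r]} :=
  [tuple (if (val j == 0)%N then - \sum_(k < r) 'X_k else Xv r (val j).-1) | j < r].

(* swap(A)(v_1,..,v_r) = A(v_r, v_(r-1) - v_r, ..., v_1 - v_2) *)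
Definition swap_sub (r : nat) : r.-tuple {mpoly rat[r]} :=
  [tuple (if (val j == 0)%N then Xv r r.-1
          else Xv r (r - val j).-1 - Xv r (r - val j)) | j < r].

Definition rot_sub (r i : nat) : r.-tuple {mpoly rat[r]} :=
  [tuple Xv r ((i + val j) %% r) | j < r].

Definition Cprod (s : seq nat) : series :=
  foldr (fun i acc => smul (Cgen i) acc) (mon [::]) s.

Definition is_comp (r n : nat) (s : r.-tuple 'I_n.+1) : bool :=
  all (fun i : 'I_n.+1 => (0 < i)%N) s && (sumn (map val s) == n).

Definition Cexp (b : series) (k : seq nat -> rat) : Prop :=
  forall r n w, wt_part n (dp_part r b) w =
    \sum_(s : r.-tuple 'I_n.+1 | is_comp s) k (map val s) * Cprod (map val s) w.

Definition Bpol (k : seq nat -> rat) (r n : nat) : {mpoly rat[r]} :=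
  \sum_(s : r.-tuple 'I_n.+1 | is_comp s)
     k (map val s) *: \prod_(j < r) 'X_j ^+ (val (tnth s j)).-1.

Definition Bstar (k : seq nat -> rat) (r n : nat) : ratfun r :=
  (Bpol k r n)%:F / ((\prod_(j < r) 'X_j) * (\sum_(j < r) 'X_j))%:F.

Definition push_invariant (k : seq nat -> rat) : Prop :=
  forall r n, (0 < r)%N -> fsub (push_sub r) (Bstar k r n) = Bstar k r n.

(* there is a constant-valued mould M_0 = (m_r)_r with swap(B_* ) + M_0
   circ-neutral.  The condition is imposed on each homogeneous component:
   the weight-n part of swap(B_* )^r is homogeneous of degree n - 2r - 1,
   so the constant m_r belongs to the component of weight n = 2r+1. *)
Definition swap_circ_const (k : seq nat -> rat) : Prop :=
  exists m : nat -> rat, forall r n, (1 < r)%N ->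
    \sum_(i < r) fsub (rot_sub r i)
        (fsub (swap_sub r) (Bstar k r n)
         + (if n == (2 * r).+1 then (m r)%:MP else 0)%:F) = 0.

Definition krv_ell (b : series) : Prop :=
  lieC b /\ exists k, [/\ Cexp b k, push_invariant k & swap_circ_const k].

(* Main.v *)
(* Over the field of rationals everything can be read off from coefficients of words.  Writing
   the depth-r part of b as the polynomial V(z_0,..,z_r) = B(z_0 - z_1,..,z_(r-1) - z_r),
   push-invariance of B_* is the invariance of V under cyclic permutation of the z_i, i.e.
   b(u y v) = b(v y u) for all words u, v.  This is exactly the condition under which
   [x,a] = [y,b] can be solved for a, coefficient by coefficient; a is then primitive for the
   unshuffling coproduct because x (x) 1 + 1 (x) x has no nontrivial commutant in positive
   depth, hence a Lie series by Dynkin's projection.  Circ-neutrality of swap(B_* ) + M_0,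
   evaluated at generic points, says that the divergence of D_{b,a}, which is b_x + a_y where
   f = f_x x + f_y y, agrees as a cyclic word with sum_r m_r [x,y]^r.  The bracket is then
   stable because the divergence is a cocycle with values in cyclic words and derivations
   killing [x,y] kill the cyclic words [x,y]^r. *)

Require Import Defs.
From HB Require Import structures.
From mathcomp Require Import all_boot all_order all_algebra.
From mathcomp Require Import fraction generic_quotient.
From mathcomp.multinomials Require Import mpoly.
From mathcomp Require Import ring lra zify.
From Stdlib Require Import FunctionalExtensionality IndefiniteDescription.
Import GRing.Theory.
Local Open Scope ring_scope.

Set Implicit Arguments.
Unset Strict Implicit.
Unset Printing Implicit Defensive.

(** Circ-neutrality reaches the divergence through a partial fraction. Put z_0 = 0 and let y be the
    remaining z_i. The denominator of [Bstar] is then y_first y_last times the product of the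
    consecutive differences of y. Its inverse is 1/y_first - 1/y_last divided by the product of the
    differences around the whole circle. That circular product is rotation-invariant, so it factors
    out of the cyclic sum. The numerators not divisible by y_first or y_last cancel against each
    other by push-invariance, and what remains is a cyclic sum of polynomials: the divergence with
    one letter y removed. In depth r the circular product is itself the generating polynomial of
    [[x,y]^(r-1), x], and that series times y equals [x,y]^r modulo commutators. This is how a
    constant m_r, placed in weight 2r+1, becomes a multiple of [x,y]^r. Polynomial identities are
    tested at rational points, so that push, swap and rotation become operations on finite
    sequences. Points with distinct non-zero entries suffice, and there no denominator vanishes. *)

Fixpoint words (n : nat) : seq word :=
  if n is n'.+1 then map (cons false) (words n') ++ map (cons true) (words n')
  else [:: [::]].

Lemma mem_words n w : (w \in words n) = (size w == n).
Proof.
elim: n w => [|n IH] [|l w] //=; first by rewrite mem_cat; apply/negbTE/norP; split;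
  apply/mapP => -[].
rewrite mem_cat eqSS -IH; case: l.
  rewrite orbC mem_map => [|? ? []//]; case: (w \in words n) => //=.
  by apply/mapP => -[].
rewrite mem_map => [|? ? []//]; case: (w \in words n) => //=.
by apply/mapP => -[].
Qed.

Lemma words_uniq n : uniq (words n).
Proof.
elim: n => //= n IH; rewrite cat_uniq !map_inj_uniq ?IH => [|? ? []//|? ? []//].
by rewrite andbT; apply/hasPn => _ /mapP[w _ ->]; apply/mapP => -[].
Qed.

Lemma eq_words n (F G : word -> rat) :
  (forall w, size w = n -> F w = G w) ->
  \sum_(w <- words n) F w = \sum_(w <- words n) G w.
Proof.
by move=> FG; apply: eq_big_seq => w; rewrite mem_words => /eqP; apply: FG.
Qed.

Lemma sum_words0 (V : nmodType) (F : word -> V) : \sum_(w <- words 0) F w = F [::].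
Proof. by rewrite big_seq1. Qed.

Lemma sum_wordsS (V : nmodType) n (F : word -> V) : \sum_(w <- words n.+1) F w =
  \sum_(w <- words n) F (false :: w) + \sum_(w <- words n) F (true :: w).
Proof. by rewrite big_cat !big_map. Qed.

Lemma sum_words_cat p q (F : word -> rat) : \sum_(w <- words (p + q)) F w =
  \sum_(u <- words p) \sum_(v <- words q) F (u ++ v).
Proof.
elim: p F => [|p IH] F; first by rewrite sum_words0.
by rewrite addSn !sum_wordsS !IH.
Qed.

Lemma sum_words_rcons n (F : word -> rat) : \sum_(w <- words n.+1) F w =
  \sum_(w <- words n) F (rcons w false) + \sum_(w <- words n) F (rcons w true).
Proof.
rewrite -addn1 sum_words_cat /= -big_split; apply: eq_words => w _.
by rewrite !big_cons big_nil addr0 !cats1.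
Qed.

Lemma sum_words_pick n t (F : word -> rat) : size t = n ->
  \sum_(w <- words n) F w * (t == w)%:R = F t.
Proof.
move=> st; rewrite (bigD1_seq t) ?words_uniq ?mem_words ?st //= eqxx mulr1.
by rewrite big1 ?addr0 // => w; rewrite eq_sym => /negbTE->; rewrite mulr0.
Qed.

Lemma sum_tuple_words n (F : word -> rat) :
  \sum_(w : n.-tuple bool) F w = \sum_(w <- words n) F w.
Proof.
rewrite -(big_map (@tval n bool) xpredT F) /=; apply: perm_big; apply: uniq_perm.
- by rewrite map_inj_uniq ?index_enum_uniq //; apply: val_inj.
- exact: words_uniq.
move=> w; rewrite mem_words; apply/mapP/eqP => [[t _ ->]|sw]; first exact: size_tuple.
by exists (Tuple (introT eqP sw)) => //; rewrite mem_index_enum.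
Qed.

Lemma depth_cat u v : depth (u ++ v) = (depth u + depth v)%N.
Proof. exact: count_cat. Qed.

Lemma depth_rcons u l : depth (rcons u l) = (depth u + l)%N.
Proof. by rewrite -cats1 depth_cat /depth /= addn0. Qed.

Lemma natr_andb (c d : bool) : (c && d)%:R = c%:R * d%:R :> rat.
Proof. by case: c d => [] []; rewrite ?mulr1 ?mulr0. Qed.

(** * Algebra of noncommutative series: quotients by a letter, products, brackets *)

Definition lquot (l : bool) (f : series) : series := fun w => f (l :: w).

Definition rquot (l : bool) (f : series) : series := fun w => f (rcons w l).

Definition letter_series (l : bool) : series := mon [:: l].

Lemma smul_nil f g : smul f g [::] = f [::] * g [::].
Proof. by rewrite /smul big_ord_recl big_ord0 addr0. Qed.

Lemma smul_cons f g l w :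
  smul f g (l :: w) = f [::] * g (l :: w) + smul (lquot l f) g w.
Proof. by rewrite /smul big_ord_recl. Qed.

Lemma lquot_smul l f g :
  lquot l (smul f g) = sadd (sscale (f [::]) (lquot l g)) (smul (lquot l f) g).
Proof. by apply: functional_extensionality => w; rewrite /lquot smul_cons. Qed.

Lemma smulDl f g h : smul (sadd f g) h = sadd (smul f h) (smul g h).
Proof.
apply: functional_extensionality => w; rewrite /smul /sadd -big_split.
by apply: eq_bigr => i _; rewrite mulrDl.
Qed.

Lemma smulDr f g h : smul h (sadd f g) = sadd (smul h f) (smul h g).
Proof.
apply: functional_extensionality => w; rewrite /smul /sadd -big_split.
by apply: eq_bigr => i _; rewrite mulrDr.
Qed.

Lemma smulZl c f h : smul (sscale c f) h = sscale c (smul f h).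
Proof.
apply: functional_extensionality => w; rewrite /smul /sscale mulr_sumr.
by apply: eq_bigr => i _; rewrite mulrA.
Qed.

Lemma smulZr c f h : smul h (sscale c f) = sscale c (smul h f).
Proof.
apply: functional_extensionality => w; rewrite /smul /sscale mulr_sumr.
by apply: eq_bigr => i _; rewrite mulrCA.
Qed.

Lemma smul0l h : smul szero h = szero.
Proof.
by apply: functional_extensionality => w; rewrite /smul big1 // => i _; rewrite mul0r.
Qed.

Lemma smul0r h : smul h szero = szero.
Proof.
by apply: functional_extensionality => w; rewrite /smul big1 // => i _; rewrite mulr0.
Qed.

Lemma smulA f g h : smul f (smul g h) = smul (smul f g) h.
Proof.
apply: functional_extensionality => w; elim: w f g => [|l w IH] f g.
  by rewrite !smul_nil mulrA.
rewrite !(smul_cons, lquot_smul) smulDl smulZl /sadd /sscale IH smul_nil.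
by rewrite mulrDr !mulrA addrA.
Qed.

Lemma smul1l f : smul (mon [::]) f = f.
Proof.
apply: functional_extensionality => -[|l w]; first by rewrite smul_nil mul1r.
rewrite smul_cons mul1r (_ : lquot l (mon [::]) = szero) ?smul0l ?addr0 //.
Qed.

Lemma smul1r f : smul f (mon [::]) = f.
Proof.
apply: functional_extensionality => w; elim: w f => [|l w IH] f.
  by rewrite smul_nil mulr1.
by rewrite smul_cons mulr0 add0r IH.
Qed.

Lemma smul_letterl l f w :
  smul (letter_series l) f w = if w is c :: w' then (c == l)%:R * f w' else 0.
Proof.
case: w => [|c w]; first by rewrite smul_nil mul0r.
rewrite smul_cons mul0r add0r -[in RHS](smul1l f).
rewrite (_ : lquot c _ = sscale (c == l)%:R (mon [::])) ?smulZl //.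
apply: functional_extensionality => u; rewrite /lquot /letter_series /mon /sscale eqseq_cons.
by rewrite natr_andb.
Qed.

Lemma smul_monl l u f :
  smul (mon (l :: u)) f = smul (letter_series l) (smul (mon u) f).
Proof.
apply: functional_extensionality => -[|c w]; first by rewrite !smul_nil !mul0r.
rewrite smul_letterl smul_cons mul0r add0r -[RHS]/(sscale _ (smul (mon u) f) w) -smulZl.
congr smul; apply: functional_extensionality => v.
by rewrite /lquot /mon /sscale eqseq_cons natr_andb.
Qed.

Lemma smul_mon u v : smul (mon u) (mon v) = mon (u ++ v).
Proof.
elim: u => [|l u IH] /=; first by rewrite smul1l.
by rewrite smul_monl IH -[RHS]smul1r smul_monl smul1r.
Qed.

Lemma mon_cons l u : mon (l :: u) = smul (letter_series l) (mon u).
Proof. by rewrite smul_mon. Qed.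

Lemma smul_rcons f g w l :
  smul f g (rcons w l) = f (rcons w l) * g [::] + smul f (rquot l g) w.
Proof.
elim: w f => [|c w IH] f /=.
  by rewrite smul_cons !smul_nil /rquot /lquot /= addrC.
by rewrite !smul_cons IH /lquot /rquot /= addrCA.
Qed.

Lemma smul_letterr_rcons l f w c :
  smul f (letter_series l) (rcons w c) = (c == l)%:R * f w.
Proof.
rewrite smul_rcons mulr0 add0r (_ : rquot c _ = sscale (c == l)%:R (mon [::])).
  by rewrite smulZr smul1r.
apply: functional_extensionality => -[|d u].
  by rewrite /rquot /letter_series /mon /sscale /= eqseq_cons natr_andb.
by rewrite /rquot /letter_series /mon /sscale mulr0 rcons_cons eqseq_cons;
  case: u => [|? ?]; rewrite andbF.
Qed.

Lemma smul_letterr_nil l f : smul f (letter_series l) [::] = 0.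
Proof. by rewrite smul_nil mulr0. Qed.

Lemma sbr_def f g : sbr f g = sadd (smul f g) (sscale (-1) (smul g f)).
Proof. by apply: functional_extensionality => w; rewrite /sbr /sadd /sscale mulN1r. Qed.

Lemma sbr_jacobi f g h : sbr h (sbr f g) = sadd (sbr (sbr h f) g) (sbr f (sbr h g)).
Proof.
rewrite !sbr_def !(smulDl, smulDr, smulZl, smulZr) !smulA.
by apply: functional_extensionality => w; rewrite /sadd /sscale; ring.
Qed.

Lemma sbrDr f g h : sbr h (sadd f g) = sadd (sbr h f) (sbr h g).
Proof.
rewrite !sbr_def !(smulDl, smulDr).
by apply: functional_extensionality => w; rewrite /sadd /sscale; ring.
Qed.

Lemma sbrZr c f h : sbr h (sscale c f) = sscale c (sbr h f).
Proof.
rewrite !sbr_def !(smulZl, smulZr).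
by apply: functional_extensionality => w; rewrite /sadd /sscale; ring.
Qed.

Lemma sbrC f g : sbr f g = sscale (-1) (sbr g f).
Proof. by apply: functional_extensionality => w; rewrite /sbr /sscale; ring. Qed.

Lemma sbrDl f g h : sbr (sadd f g) h = sadd (sbr f h) (sbr g h).
Proof.
rewrite !sbr_def !(smulDl, smulDr).
by apply: functional_extensionality => w; rewrite /sadd /sscale; ring.
Qed.

Lemma sbrZl c f h : sbr (sscale c f) h = sscale c (sbr f h).
Proof.
rewrite !sbr_def !(smulZl, smulZr).
by apply: functional_extensionality => w; rewrite /sadd /sscale; ring.
Qed.

Lemma sbr0r f : sbr f szero = szero.
Proof.
rewrite sbr_def smul0l smul0r.
by apply: functional_extensionality => w; rewrite /sadd /sscale /szero; ring.
Qed.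

Lemma sbrxx f : sbr f f = szero.
Proof. by apply: functional_extensionality => w; rewrite /sbr subrr. Qed.

Lemma sum_smul n f g (phi : word -> rat) :
  \sum_(w <- words n) smul f g w * phi w =
  \sum_(i < n.+1) \sum_(u <- words i) \sum_(v <- words (n - i)) f u * g v * phi (u ++ v).
Proof.
under eq_words => w sw do rewrite /smul sw mulr_suml.
rewrite exchange_big; apply: eq_bigr => i _.
have ni : (i + (n - i))%N = n by rewrite subnKC // -ltnS.
rewrite -{1}ni sum_words_cat; apply: eq_words => u su; apply: eq_words => v sv.
by rewrite -su take_size_cat // drop_size_cat.
Qed.

(** * The derivation [der b a] *)

Lemma coef_mid_cons l u1 u2 g v : coef_mid (l :: u1) u2 g v =
  if v is c :: v' then (c == l)%:R * coef_mid u1 u2 g v' else 0.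
Proof.
case: v => [|c v]; rewrite /coef_mid //=.
rewrite addSn ltnS eqseq_cons; case: leqP => [suv|]; last by rewrite mulr0.
rewrite subSn ?(leq_trans _ suv) ?leq_addl //=.
case: (c == l); rewrite ?mul1r ?mul0r //=.
Qed.

Lemma coef_mid_nil u2 g v : coef_mid [::] u2 g v = smul g (mon u2) v.
Proof.
rewrite /coef_mid /smul /= take0 eqxx subn0 drop0 /=.
case: (leqP (size u2) (size v)) => [le|lt] /=; last first.
  rewrite big1 // => i _; rewrite /mon; case: eqP => [e|]; last by rewrite mulr0.
  by move: lt; rewrite -e size_drop ltnNge leq_subr.
have lti : (size v - size u2 < (size v).+1)%N by rewrite ltnS leq_subr.
rewrite (bigD1 (Ordinal lti)) //= big1 ?addr0; first last.
  move=> i ni; rewrite /mon; case: eqP => [e|]; last by rewrite mulr0.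
  case/eqP: ni; apply: val_inj; rewrite /= -e size_drop subKn //.
  by rewrite -ltnS.
by rewrite /mon; case: eqP => _; rewrite ?mulr1 ?mulr0.
Qed.

Lemma der_word_nil b a v : der_word b a [::] v = 0.
Proof. by rewrite /der_word big_ord0. Qed.

Lemma der_word_cons b a l w : der_word b a (l :: w) =
  sadd (smul (if l then a else b) (mon w)) (smul (letter_series l) (der_word b a w)).
Proof.
apply: functional_extensionality => v.
rewrite /der_word big_ord_recl /= drop0 coef_mid_nil; congr (_ + _).
under eq_bigr => i _ do rewrite coef_mid_cons.
rewrite smul_letterl; case: v => [|c v]; first by rewrite big1.
by rewrite -mulr_sumr.
Qed.

Lemma der_word_cat b a u v : der_word b a (u ++ v) =
  sadd (smul (der_word b a u) (mon v)) (smul (mon u) (der_word b a v)).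
Proof.
elim: u => [|l u IH] /=.
  rewrite smul1l (_ : der_word b a [::] = szero).
    by rewrite smul0l; apply: functional_extensionality => w; rewrite /sadd add0r.
  by apply: functional_extensionality => w; rewrite der_word_nil.
rewrite !der_word_cons IH -smul_mon smulDl smulDr smul_monl !smulA.
by apply: functional_extensionality => w; rewrite /sadd addrA.
Qed.

Lemma derE b a f v : der b a f v =
  \sum_(n < (size v).+1) \sum_(w <- words n) f w * der_word b a w v.
Proof. by apply: eq_bigr => n _; apply: (sum_tuple_words n (fun w => f w * der_word b a w v)). Qed.

(** Continuity of the extended derivation: a Lie series may be replaced by a Lie polynomial agreeing
    with it up to the length of [v], which opens the way to induction on [lie_span]. *)
Lemma der_local b a f f' v : (forall w, (size w <= size v)%N -> f w = f' w) ->
  der b a f v = der b a f' v.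
Proof.
move=> ff; rewrite !derE; apply: eq_bigr => n _; apply: eq_words => w sw.
by rewrite ff // sw -ltnS.
Qed.

Lemma derD b a f g : der b a (sadd f g) = sadd (der b a f) (der b a g).
Proof.
apply: functional_extensionality => v; rewrite /sadd !derE -big_split.
apply: eq_bigr => n _; rewrite -big_split; apply: eq_words => w _.
by rewrite mulrDl.
Qed.

Lemma derZ b a c f : der b a (sscale c f) = sscale c (der b a f).
Proof.
apply: functional_extensionality => v; rewrite /sscale !derE mulr_sumr.
apply: eq_bigr => n _; rewrite mulr_sumr; apply: eq_words => w _.
by rewrite mulrA.
Qed.

Lemma der0 b a : der b a szero = szero.
Proof.
apply: functional_extensionality => v; rewrite derE big1 // => n _.
by rewrite big1 // => w _; rewrite mul0r.
Qed.

Section Derivation.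
Variables b a : series.
Hypotheses (b0 : b [::] = 0) (a0 : a [::] = 0).

(** Prefix lengths are traded for suffix lengths, the index used by [der]. The suffix equal to all
    of [v] is absent from the sum because it would pair with [g [::] = 0]. *)
Lemma smul_sum_words g h v : g [::] = 0 -> smul g h v =
  \sum_(n < size v) \sum_(w <- words n) h w * smul g (mon w) v.
Proof.
move=> g0.
rewrite [LHS]/smul (reindex_inj rev_ord_inj) big_ord_recr /= subnn take0 g0 mul0r addr0.
apply: eq_bigr => i _ /=; rewrite subSS.
have sd : size (drop (size v - i) v) = i by rewrite size_drop subKn // ltnW.
rewrite -(sum_words_pick (fun w => _ * h w) sd); apply: eq_words => w sw.
rewrite -coef_mid_nil /coef_mid /= take0 eqxx /= subn0 drop0 sw (ltnW (ltn_ord i)).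
by case: eqP => _ /=; rewrite ?mulr0 ?mulr1 // mulrC.
Qed.

(** The Leibniz rule on f = f(1) + x f_x + y f_y, with f_x and f_y the left quotients. Combined with
    induction on [v], it replaces the double sum that defines [der]. *)
Lemma der_rec f v : der b a f v =
  smul b (lquot false f) v + smul a (lquot true f) v +
  (if v is l :: v' then der b a (lquot l f) v' else 0).
Proof.
rewrite derE big_ord_recl /= sum_words0 der_word_nil mulr0 add0r.
rewrite (smul_sum_words _ _ b0) (smul_sum_words _ _ a0) -big_split /=.
transitivity (\sum_(n < size v) (\sum_(w <- words n) lquot false f w * smul b (mon w) v +
    \sum_(w <- words n) lquot true f w * smul a (mon w) v) +
  \sum_(n < size v) (\sum_(w <- words n) f (false :: w) * smul X (der_word b a w) v +
    \sum_(w <- words n) f (true :: w) * smul Y (der_word b a w) v)).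
  rewrite -big_split; apply: eq_bigr => n _.
  rewrite /bump /= sum_wordsS /= addrACA; congr (_ + _); rewrite -big_split;
    by apply: eq_words => w _; rewrite der_word_cons /sadd mulrDr.
congr (_ + _); case: v => [|l v]; first by rewrite big_ord0.
rewrite derE; apply: eq_bigr => n _; move: (n : nat) => {n} n.
rewrite -big_split; apply: eq_words => w _ /=.
by rewrite !smul_letterl /lquot; case: l; rewrite ?mul1r ?mul0r ?mulr0 ?addr0 ?add0r.
Qed.

Lemma der_smul f g : der b a (smul f g) = sadd (smul (der b a f) g) (smul f (der b a g)).
Proof.
apply: functional_extensionality => v.
(* This is [der_rec] multiplied by [g] on the right. It is stated for every series because the
   induction on [v] passes to left quotients of [f]. *)
have expand f' v' : smul (der b a f') g v' = smul b (smul (lquot false f') g) v' +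
    smul a (smul (lquot true f') g) v' +
    (if v' is l :: v' then smul (der b a (lquot l f')) g v' else 0).
  have -> : der b a f' = sadd (sadd (smul b (lquot false f')) (smul a (lquot true f')))
    (fun v => if v is l :: v' then der b a (lquot l f') v' else 0).
    by apply: functional_extensionality => w; rewrite der_rec.
  rewrite !smulDl -!smulA /sadd; congr (_ + _).
  by case: v' => [|l v']; rewrite ?smul_nil ?smul_cons mul0r ?add0r.
elim: v f expand => [|l v IH] f expand.
  rewrite /sadd expand der_rec !lquot_smul !smulDr !smulZr /sadd /sscale.
  rewrite [smul f _ _]smul_nil der_rec; ring.
rewrite [RHS]/sadd expand der_rec !lquot_smul !smulDr !smulZr derD derZ.
rewrite /sadd /sscale IH // [smul f _ _]smul_cons [der b a g (l :: v)]der_rec /sadd.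
ring.
Qed.

Lemma der_sbr f g : der b a (sbr f g) = sadd (sbr (der b a f) g) (sbr f (der b a g)).
Proof.
rewrite !sbr_def derD derZ !der_smul.
by apply: functional_extensionality => w; rewrite /sadd /sscale; ring.
Qed.

Lemma der_letter l : der b a (letter_series l) = if l then a else b.
Proof.
apply: functional_extensionality => v; rewrite der_rec.
have q c : lquot c (letter_series l) = if c == l then mon [::] else szero.
  by case: c l => [] [].
have z c w : (if w is l' :: v' then der b a (if c l' then mon [::] else szero) v' else 0) = 0.
  case: w => // l' v'; case: (c l'); last by rewrite der0.
  rewrite derE big1 // => n _; case: n => -[|n] ltn; first by rewrite sum_words0 der_word_nil mulr0.
  by rewrite big1_seq // => w /andP[_]; rewrite mem_words; case: w => // *; rewrite mul0r.
rewrite !q; have -> : (if v is l0 :: v' then der b a (lquot l0 (letter_series l)) v' else 0) = 0.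
  by rewrite -[RHS](z (fun c => c == l) v); case: v => // c v; rewrite q.
by case: l {q}; rewrite /= ?smul1r ?smul0r ?addr0 ?add0r.
Qed.

End Derivation.

(** * Primitive series *)

(* The sum of [H u v] over the pairs of complementary subwords [u], [v] of [w],
   i.e. the unshuffling coproduct of [w] paired with [H]. *)
Fixpoint unshuffle (w : word) (H : word -> word -> rat) : rat :=
  if w is l :: w' then unshuffle w' (fun u v => H (l :: u) v + H u (l :: v))
  else H [::] [::].

Lemma eq_unshuffle w (H H' : word -> word -> rat) :
  (forall u v, (size u + size v = size w)%N -> (depth u + depth v = depth w)%N ->
    H u v = H' u v) -> unshuffle w H = unshuffle w H'.
Proof.
elim: w H H' => [|l w IH] H H' HH /=; first exact: HH.
by apply: IH => u v suv duv; rewrite !HH //= /depth /= -?/(depth _); lia.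
Qed.

Lemma unshuffleD w H H' : unshuffle w (fun u v => H u v + H' u v) =
  unshuffle w H + unshuffle w H'.
Proof.
elim: w H H' => //= l w IH H H'; rewrite -IH; apply: eq_unshuffle => u v _ _; ring.
Qed.

Lemma unshuffleZ w c H : unshuffle w (fun u v => c * H u v) = c * unshuffle w H.
Proof.
elim: w H => //= l w IH H; rewrite -IH; apply: eq_unshuffle => u v _ _; ring.
Qed.

Lemma unshuffle0 w : unshuffle w (fun _ _ => 0) = 0.
Proof.
by elim: w => //= l w IH; rewrite -[RHS]IH; apply: eq_unshuffle => u v _ _; rewrite addr0.
Qed.

Lemma unshuffle_cat w1 w2 H : unshuffle (w1 ++ w2) H =
  unshuffle w1 (fun u1 v1 => unshuffle w2 (fun u2 v2 => H (u1 ++ u2) (v1 ++ v2))).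
Proof.
elim: w1 H => //= l w1 IH H; rewrite IH; apply: eq_unshuffle => u v _ _.
exact: unshuffleD.
Qed.

Lemma unshuffle_rcons w l H : unshuffle (rcons w l) H =
  unshuffle w (fun u v => H (rcons u l) v + H u (rcons v l)).
Proof.
rewrite -cats1 unshuffle_cat /=; apply: eq_unshuffle => u v _ _.
by rewrite !cats1 !cats0.
Qed.

Lemma unshuffleC w H : unshuffle w H = unshuffle w (fun u v => H v u).
Proof.
elim: w H => //= l w IH H; rewrite IH; apply: eq_unshuffle => u v _ _.
by rewrite addrC.
Qed.

Lemma unshuffle_niln w K :
  unshuffle w (fun u v => (nilp u)%:R * K v) = K w.
Proof.
elim: w K => [|l w IH] K /=; first by rewrite mul1r.
rewrite -[RHS](IH (fun v => K (l :: v))); apply: eq_unshuffle => u v _ _.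
by rewrite mul0r add0r.
Qed.

(** The equation Delta f = f (x) 1 + 1 (x) f in dual form: each degree is paired with an arbitrary
    functional [H] on pairs of words, so that no completed tensor product has to be built. *)
Definition primitive (f : series) : Prop := forall n H,
  \sum_(w <- words n) f w * unshuffle w H =
  \sum_(w <- words n) f w * (H w [::] + H [::] w).

Lemma primitive_nil f : primitive f -> f [::] = 0.
Proof.
move/(_ 0%N (fun _ _ => 1)); rewrite !sum_words0 /= => e.
by apply/eqP; rewrite -[_ == _]orbF -(mulf_eq0 _ 1) -subr_eq0 -oppr_eq0; apply/eqP; lra.
Qed.

Lemma primitive_local f : (forall n, exists p, primitive p /\
  forall w, size w = n -> f w = p w) -> primitive f.
Proof.
move=> fp n H; have [p [pp fE]] := fp n.
under eq_words => w sw do rewrite fE //.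
by rewrite pp; apply: eq_words => w sw; rewrite fE.
Qed.

Lemma primitive0 : primitive szero.
Proof. by move=> n H; apply: eq_words => w _; rewrite !mul0r. Qed.

Lemma primitiveD f g : primitive f -> primitive g -> primitive (sadd f g).
Proof.
move=> pf pg n H; under eq_words => w _ do rewrite mulrDl.
by rewrite big_split pf pg -big_split; apply: eq_words => w _; rewrite /= /sadd mulrDl.
Qed.

Lemma primitiveZ c f : primitive f -> primitive (sscale c f).
Proof.
move=> pf n H; under eq_words => w _ do rewrite -mulrA.
by rewrite -mulr_sumr pf mulr_sumr; apply: eq_words => w _; rewrite /sscale mulrA.
Qed.

Lemma primitive_letter l : primitive (letter_series l).
Proof.
move=> n H; apply: eq_words => w _; rewrite /letter_series /mon.
by case: eqP => [->|_]; rewrite ?mul0r.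
Qed.

Lemma sum_pairsC n (F : word -> word -> rat) :
  \sum_(i < n.+1) \sum_(u <- words i) \sum_(v <- words (n - i)) F u v =
  \sum_(i < n.+1) \sum_(u <- words i) \sum_(v <- words (n - i)) F v u.
Proof.
rewrite (reindex_inj rev_ord_inj); apply: eq_bigr => i _ /=.
by rewrite subSS exchange_big /= subKn // -ltnS.
Qed.

(** Delta is multiplicative, so Delta(fg) has the extra terms f (x) g + g (x) f. They are symmetric
    in f and g and therefore cancel in the bracket. *)
Lemma primitive_smul f g n H : primitive f -> primitive g ->
  \sum_(w <- words n) smul f g w * unshuffle w H =
  \sum_(w <- words n) smul f g w * (H w [::] + H [::] w) +
  \sum_(i < n.+1) \sum_(u <- words i) \sum_(v <- words (n - i))
     f u * g v * (H u v + H v u).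
Proof.
move=> pf pg; rewrite !sum_smul -big_split; apply: eq_bigr => i _ /=.
under eq_words => u _.
  under eq_words => v _ do rewrite unshuffle_cat mulrAC.
  over.
rewrite exchange_big /=.
under eq_words => v _ do rewrite -mulr_suml mulrC pf mulr_sumr.
rewrite exchange_big -big_split; apply: eq_words => u _ /=.
under eq_words => v _ do rewrite mulrA [g v * _]mulrC -mulrA -unshuffleD.
rewrite -mulr_sumr pg mulr_sumr -big_split; apply: eq_words => v _ /=.
by rewrite !cats0; ring.
Qed.

Lemma primitive_sbr f g : primitive f -> primitive g -> primitive (sbr f g).
Proof.
move=> pf pg n H.
under eq_words => w _ do rewrite mulrBl.
under [RHS]eq_words => w _ do rewrite mulrBl.
rewrite !sumrB !primitive_smul // [X in _ - (_ + X)]sum_pairsC.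
rewrite opprD addrACA [X in _ + X = _](_ : _ = 0) ?addr0 //.
apply/eqP; rewrite subr_eq0; apply/eqP; apply: eq_bigr => i _.
by apply: eq_words => u _; apply: eq_words => v _; ring.
Qed.

Lemma lie_span_sub (S T : series -> Prop) p :
  (forall s, S s -> lie_span T s) -> lie_span S p -> lie_span T p.
Proof.
move=> ST; elim=> [s /ST //||f g _ ? _ ?|c f _ ?|f g _ ? _ ?].
- exact: ls_zero.
- exact: ls_add.
- exact: ls_scale.
- exact: ls_br.
Qed.

Definition isXY (s : series) := s = X \/ s = Y.

Definition isC (s : series) := exists2 i, (0 < i)%N & s = Cgen i.

Lemma primitive_lie_span p : lie_span isXY p -> primitive p.
Proof.
elim=> [s [] ->||f g _ ? _ ?|c f _ ?|f g _ ? _ ?].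
- exact: primitive_letter.
- exact: primitive_letter.
- exact: primitive0.
- exact: primitiveD.
- exact: primitiveZ.
- exact: primitive_sbr.
Qed.

Lemma lie_span_sum S (I : Type) (s : seq I) (c : I -> rat) (D : I -> series) :
  (forall i, lie_span S (D i)) ->
  lie_span S (fun t => \sum_(i <- s) c i * D i t).
Proof.
move=> SD; elim: s => [|i s IH].
  rewrite (_ : (fun _ => _) = szero); first exact: ls_zero.
  by apply: functional_extensionality => t; rewrite big_nil.
rewrite (_ : (fun _ => _) = sadd (sscale (c i) (D i)) (fun t => \sum_(i <- s) c i * D i t)).
  by apply: ls_add IH; apply: ls_scale.
by apply: functional_extensionality => t; rewrite big_cons.
Qed.

Fixpoint dynkin (w : word) : series :=
  if w is l :: w' then
    if w' is [::] then letter_series l else sbr (letter_series l) (dynkin w')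
  else szero.

Lemma dynkin_cons l w : dynkin (l :: w) =
  sadd (sbr (letter_series l) (dynkin w)) (sscale (nilp w)%:R (letter_series l)).
Proof.
case: w => [|c w]; apply: functional_extensionality => t; rewrite /sadd /sscale.
  by rewrite [dynkin [::]]/= sbr0r add0r mul1r.
by rewrite mul0r addr0.
Qed.

Lemma lie_span_dynkin w : lie_span isXY (dynkin w).
Proof.
elim: w => [|l w IH]; first exact: ls_zero.
have Sl : lie_span isXY (letter_series l).
  by apply: ls_gen; case: l; [right|left].
by case: w IH => [//|c w] IH; apply: ls_br.
Qed.

(** The convolution of Dynkin's operator with the identity is multiplication by the degree. If the
    new letter l joins u, it gives l D(u) v - D(u) l v; if it joins v, it gives D(u) l v, which
    cancels the second term. The case of empty u supplies one further copy of l w. *)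
Lemma unshuffle_dynkin w t :
  unshuffle w (fun u v => smul (dynkin u) (mon v) t) = (size w)%:R * mon w t.
Proof.
elim: w t => [|l w IH] t /=; first by rewrite smul0l mul0r.
transitivity (unshuffle w (fun u v =>
   (if t is c :: t' then (c == l)%:R * smul (dynkin u) (mon v) t' else 0)
   + (nilp u)%:R * mon (l :: v) t)).
  apply: eq_unshuffle => u v _ _; rewrite -/(dynkin (l :: u)) dynkin_cons.
  rewrite -smul_letterl smulDl smulZl sbr_def smulDl smulZl !mon_cons !smulA.
  by rewrite /sadd /sscale; ring.
rewrite unshuffleD unshuffle_niln mulrS mulrDl mul1r [RHS]addrC; congr (_ + _).
case: t => [|c t]; first by rewrite unshuffle0 /mon mulr0.
by rewrite unshuffleZ IH {2}/mon eqseq_cons natr_andb mulrCA.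
Qed.

(** On a primitive series only the splittings (w, 1) and (1, w) count, and the second dies since
    [dynkin [::]] is zero. Hence n f_n is a combination of iterated brackets. *)
Lemma primitive_dynkin f n t : primitive f ->
  wt_part n f t * n%:R = \sum_(w <- words n) f w * dynkin w t.
Proof.
move/(_ n (fun u v => smul (dynkin u) (mon v) t)).
under eq_words => w sw do rewrite unshuffle_dynkin sw.
under [in RHS]eq_words => w _ do rewrite smul0l addr0 smul1r.
move=> <-; rewrite /wt_part; case: eqP => [st|st].
  rewrite -[X in X * _ = _](sum_words_pick f st) mulr_suml; apply: eq_words => w _.
  by rewrite /mon; ring.
rewrite mul0r big1_seq // => w /andP[_]; rewrite mem_words => /eqP sw.
by rewrite /mon; case: eqP => [tw|]; [case: st; rewrite tw|rewrite !mulr0].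
Qed.

Lemma lie2P f : lie2 f <-> primitive f.
Proof.
split=> [lf|pf].
  apply: primitive_local => n; have [p [lp fp]] := lf n; exists p.
  by split=> [|w sw]; [exact: primitive_lie_span|rewrite -fp /wt_part sw eqxx].
move=> [|n].
  exists szero; split=> [|w]; first exact: ls_zero.
  by rewrite /wt_part /szero; case: eqP => // /size0nil ->; rewrite primitive_nil.
exists (sscale n.+1%:R^-1 (fun t => \sum_(w <- words n.+1) f w * dynkin w t)).
split=> [|t]; first by apply: ls_scale; apply: lie_span_sum; apply: lie_span_dynkin.
by rewrite /sscale -primitive_dynkin // mulrC mulfK // Num.Theory.pnatr_eq0.
Qed.

Lemma lie_span_adX q : lie_span isC q -> lie_span isC (sbr X q).
Proof.
elim=> [s [i i0 ->]||f g _ Cf _ Cg|c f _ Cf|f g sf Cf sg Cg].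
- by apply: ls_gen; exists i.+1 => //; case: i i0.
- rewrite sbr0r; exact: ls_zero.
- by rewrite sbrDr; apply: ls_add.
- by rewrite sbrZr; apply: ls_scale.
by rewrite sbr_jacobi; apply: ls_add; apply: ls_br.
Qed.

(** Lazard elimination: every Lie polynomial is a multiple of x plus an element of the Lie algebra
    of the C_i. Brackets respect this form because that Lie algebra is stable under ad(x). *)
Lemma lie_span_XY_split p : lie_span isXY p ->
  exists c q, lie_span isC q /\ p = sadd (sscale c X) q.
Proof.
have zl f : sadd (sscale 0 X) f = f.
  by apply: functional_extensionality => w; rewrite /sadd /sscale mul0r add0r.
elim=> [s [] ->||_ _ _ [c [q [Cq ->]]] _ [c' [q' [Cq' ->]]]|d _ _ [c [q [Cq ->]]]
   |_ _ _ [c [q [Cq ->]]] _ [c' [q' [Cq' ->]]]].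
- exists 1, szero; split; first exact: ls_zero.
  by apply: functional_extensionality => w; rewrite /sadd /sscale mul1r addr0.
- by exists 0, Y; split; [apply: ls_gen; exists 1%N|rewrite zl].
- by exists 0, szero; split; [exact: ls_zero|rewrite zl].
- exists (c + c'), (sadd q q'); split; first exact: ls_add.
  by apply: functional_extensionality => w; rewrite /sadd /sscale; ring.
- exists (d * c), (sscale d q); split; first exact: ls_scale.
  by apply: functional_extensionality => w; rewrite /sadd /sscale; ring.
exists 0, (sadd (sadd (sscale c (sbr X q')) (sscale (- c') (sbr X q))) (sbr q q')); split.
  by apply: ls_add; [apply: ls_add; apply: ls_scale; apply: lie_span_adX|apply: ls_br].
rewrite zl !(sbrDl, sbrDr, sbrZl, sbrZr) sbrxx (sbrC q X).
by apply: functional_extensionality => w; rewrite /sadd /sscale /szero; ring.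
Qed.

Definition no_depth0 (f : series) := forall w, depth w = 0%N -> f w = 0.

Lemma no_depth0_smul f g : no_depth0 g -> no_depth0 (smul f g) /\ no_depth0 (smul g f).
Proof.
move=> g0; have dt i w : depth w = 0%N -> depth (take i w) = 0%N /\ depth (drop i w) = 0%N.
  by rewrite -{1}(cat_take_drop i w) depth_cat => /eqP; rewrite addn_eq0 => /andP[/eqP ? /eqP].
by split=> w dw; rewrite /smul big1 // => i _; have [d1 d2] := dt i w dw;
  rewrite g0 // ?mulr0 ?mul0r.
Qed.

Lemma no_depth0_sbr f g : no_depth0 g -> no_depth0 (sbr f g).
Proof.
move=> g0 w dw; have [h1 h2] := no_depth0_smul f g0.
by rewrite /sbr h1 // h2 // subrr.
Qed.

Lemma no_depth0_Cgen i : no_depth0 (Cgen i).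
Proof.
rewrite /Cgen; elim: i.-1 => [|j IH] /=; last exact: no_depth0_sbr.
by move=> w; rewrite /Y /mon; case: eqP => // ->.
Qed.

Lemma no_depth0_lie_span q : lie_span isC q -> no_depth0 q.
Proof.
elim=> [s [i _ ->]|//|f g _ f0 _ g0 w dw|c f _ f0 w dw|f g _ f0 _ g0].
- exact: no_depth0_Cgen.
- by rewrite /sadd f0 // g0 // addr0.
- by rewrite /sscale f0 // mulr0.
exact: no_depth0_sbr.
Qed.

Lemma lieC_no_depth0 f : lieC f -> no_depth0 f.
Proof.
move=> Cf w dw; have [p [Cp fp]] := Cf (size w).
by rewrite -(no_depth0_lie_span Cp dw) -fp /wt_part eqxx.
Qed.

(** By elimination the linear term in x is the only obstruction for a Lie series to lie in [lieC].
    Membership thus becomes a condition on coefficients, without reference to the C_i. *)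
Lemma lieCP f : lieC f <-> primitive f /\ f [:: false] = 0.
Proof.
split=> [Cf|[/lie2P lf fx]].
  split; last exact: lieC_no_depth0.
  apply/lie2P => n; have [p [Cp fp]] := Cf n; exists p; split=> //.
  apply: lie_span_sub Cp => _ [i _ ->]; rewrite /Cgen; elim: i.-1 => [|j IH] /=.
    by apply: ls_gen; right.
  by apply: ls_br IH; apply: ls_gen; left.
move=> n; have [p [/lie_span_XY_split [c [q [Cq pE]]] fp]] := lf n.
exists q; split=> // w; rewrite fp pE.
suff -> : c = 0 by rewrite /sadd /sscale mul0r add0r.
have := fp [:: false]; rewrite pE /sadd /sscale /X /mon eqxx mulr1 /wt_part fx.
by rewrite (no_depth0_lie_span Cq) // addr0; case: ifP => _ <-.
Qed.

Lemma lie2_approx f N : lie2 f -> exists p, lie_span isXY p /\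
  forall w, (size w <= N)%N -> f w = p w.
Proof.
move=> lf; suff [p [sp pE]] : exists p, lie_span isXY p /\
    forall w, p w = if (size w <= N)%N then f w else 0.
  by exists p; split=> // w sw; rewrite pE sw.
elim: N => [|N [p [sp pE]]].
  have [p [sp pE]] := lf 0%N; exists p; split=> // w.
  by rewrite -pE /wt_part leqn0.
have [q [sq qE]] := lf N.+1; exists (sadd p q); split; first exact: ls_add.
move=> w; rewrite /sadd pE -qE /wt_part [(_ <= N.+1)%N]leq_eqVlt ltnS.
case: eqP => [->|_]; first by rewrite ltnn add0r.
by rewrite addr0.
Qed.

Lemma primitive_der b a f : primitive b -> primitive a -> primitive f ->
  primitive (der b a f).
Proof.
move=> pb pa /lie2P lf; have b0 := primitive_nil pb; have a0 := primitive_nil pa.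
apply: primitive_local => n; have [p [sp fp]] := lie2_approx n lf.
exists (der b a p); split; last first.
  by move=> w sw; apply: der_local => v; rewrite sw; apply: fp.
elim: sp => [s [] ->||g h _ pg _ ph|c g _ pg|g h sg pg sh ph].
- by rewrite (der_letter b0 a0 false).
- by rewrite (der_letter b0 a0 true).
- by rewrite der0; apply: primitive0.
- by rewrite derD; apply: primitiveD.
- by rewrite derZ; apply: primitiveZ.
by rewrite der_sbr //; apply: primitiveD; apply: primitive_sbr => //;
  apply: primitive_lie_span.
Qed.

Section PrimitiveOfCommutator.
Variable a : series.
Hypotheses (a_depth0 : no_depth0 a) (pXa : primitive (sbr X a)).

(** The degree-n part of Delta a - a (x) 1 - 1 (x) a, paired with [H]. *)
Let defect n (H : word -> word -> rat) :=
  \sum_(w <- words n) a w * (unshuffle w H - H w [::] - H [::] w).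

(** Transpose of the commutator with x (x) 1 + 1 (x) x. *)
Let adX_dual (H : word -> word -> rat) u v :=
  H (false :: u) v + H u (false :: v) - H (rcons u false) v - H u (rcons v false).

Let defectD n H H' : defect n (fun u v => H u v + H' u v) = defect n H + defect n H'.
Proof.
by rewrite /defect -big_split; apply: eq_words => w _; rewrite unshuffleD /=; ring.
Qed.

(** Since [x,a] is primitive and Delta x = x (x) 1 + 1 (x) x, the defect of [a] commutes with x (x)
    1 + 1 (x) x. *)
Let defect_adX n H : defect n (adX_dual H) = 0.
Proof.
pose Z w := unshuffle w H - H w [::] - H [::] w.
have : \sum_(w <- words n.+1) sbr X a w * Z w = 0.
  have := pXa n.+1 H => /eqP; rewrite -subr_eq0 -sumrB => /eqP e0; rewrite -[RHS]e0.
  by apply: eq_words => w _; rewrite /Z; ring.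
under eq_words => w _ do rewrite /sbr mulrBl.
rewrite sumrB sum_wordsS sum_words_rcons => e0; rewrite -[RHS]e0.
rewrite -!big_split -sumrB; apply: eq_words => w _.
rewrite /= -!/(letter_series false) !smul_letterl !smul_letterr_rcons /Z /=.
rewrite unshuffle_rcons !mul1r !mul0r !addr0 -mulrBr; congr (_ * _).
rewrite /adX_dual.
have -> : unshuffle w (fun u v => H (false :: u) v + H u (false :: v) -
    H (rcons u false) v - H u (rcons v false)) =
   unshuffle w (fun u v => H (false :: u) v + H u (false :: v)) -
   unshuffle w (fun u v => H (rcons u false) v + H u (rcons v false)).
  rewrite -mulN1r -unshuffleZ -unshuffleD; apply: eq_unshuffle => u v _ _; ring.
rewrite /=; ring.
Qed.

Let far k (u : word) := (0 < depth u)%N && (k <= find id u)%N.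

(** This is why [far] demands a letter y in [u]: a final x then leaves the leading run of x's
    unchanged, whereas it would lengthen a pure power of x. *)
Let far_rcons k u : far k (rcons u false) = far k u.
Proof.
rewrite /far depth_rcons addn0 -cats1 find_cat has_count -/(depth u).
by case: (0 < depth u)%N.
Qed.

(* Descending induction on the number of leading x's of [u]: subtracting
   [adX_dual] of the shift of [H] pushes the support one step further. *)
Let defect_far n k H : (forall u v, ~~ far k u -> H u v = 0) -> defect n H = 0.
Proof.
have [m] := ubnP (n.+1 - k); elim: m k H => // m IH k H; rewrite ltnS => mk Hk.
have [nk|kn] := ltnP n k.
  rewrite /defect big1_seq // => w /andP[_]; rewrite mem_words => /eqP sw.
  have H0 u v : (size u <= n)%N -> H u v = 0.
    move=> su; apply: Hk; apply/nandP; right; rewrite -ltnNge.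
    by apply: leq_ltn_trans nk; apply: leq_trans su; apply: find_size.
  rewrite !H0 ?sw // (@eq_unshuffle _ _ (fun _ _ => 0)) ?unshuffle0 ?subrr ?mulr0 //.
  by move=> u v suv _; rewrite H0 // -sw -suv leq_addr.
pose H' (u v : word) := if u is false :: u' then H u' v else 0.
pose K u v := - H' u (false :: v) + H' (rcons u false) v + H' u (rcons v false).
have -> : H = fun u v => adX_dual H' u v + K u v.
  apply: functional_extensionality => u; apply: functional_extensionality => v.
  by rewrite /adX_dual /K /=; ring.
rewrite defectD defect_adX add0r; apply: (IH k.+1); first by lia.
move=> u v nu; have H'0 s : H' u s = 0.
  by case: u nu => [|[] u] //= nu; rewrite Hk.
rewrite /K !H'0 oppr0 add0r addr0; case: u nu {H'0} => [|[] u] //= nu.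
  by rewrite Hk.
by rewrite Hk // far_rcons.
Qed.

Let defectC n H : defect n H = defect n (fun u v => H v u).
Proof.
by apply: eq_words => w _; rewrite unshuffleC; ring.
Qed.

Lemma primitive_of_sbrX : primitive a.
Proof.
move=> n H; apply/eqP; rewrite -subr_eq0 -sumrB; apply/eqP.
transitivity (defect n H); first by apply: eq_words => w _; ring.
(* The test functional is cut by the position of the y's. [H1] is covered by [defect_far], [H2] is
   covered too after exchanging the factors by cocommutativity, and [H3] sees only words without y,
   where [a] vanishes. *)
pose H1 (u v : word) := if (0 < depth u)%N then H u v else 0.
pose H2 (u v : word) := if (0 < depth u)%N then 0 else if (0 < depth v)%N then H u v else 0.
pose H3 (u v : word) := if (0 < depth u + depth v)%N then 0 else H u v.
have -> : H = fun u v => H1 u v + H2 u v + H3 u v.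
  apply: functional_extensionality => u; apply: functional_extensionality => v.
  rewrite /H1 /H2 /H3 addn_gt0.
  by case: (0 < depth u)%N; case: (0 < depth v)%N; rewrite ?addr0 ?add0r.
rewrite (defectD n (fun u v => H1 u v + H2 u v)) defectD (@defect_far n 0 H1); last first.
  by move=> u v; rewrite /far /H1 andbT => /negbTE->.
rewrite (defectC n H2) (@defect_far n 0 (fun u v => H2 v u)) ?add0r; last first.
  by move=> u v; rewrite /far /H2 andbT => /negbTE->; rewrite if_same.
rewrite /defect big1 // => w _.
have [/a_depth0 ->|dw] := eqVneq (depth w) 0%N; first by rewrite mul0r.
rewrite /H3 addn0 add0n lt0n dw (@eq_unshuffle _ _ (fun _ _ => 0)) ?unshuffle0 ?subrr ?mulr0 //.
by move=> u v _ ->; rewrite lt0n dw.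
Qed.

End PrimitiveOfCommutator.

(** * Partners and push-invariance *)

Lemma nseq_catr (T : Type) j (x : T) t : nseq j x ++ x :: t = x :: nseq j x ++ t.
Proof. by elim: j => //= j ->. Qed.

Lemma rcons_nseq (T : Type) j (x : T) : rcons (nseq j x) x = x :: nseq j x.
Proof. by elim: j => //= j ->. Qed.

Definition push_sym (b : series) := forall u v, b (u ++ true :: v) = b (v ++ true :: u).

(* [revpart b j (rev (u ++ [:: y]))] is [- b (x^(j+1) u)], so that
   [partner b (u y x^j) = - b (x^(j+1) u)]. *)
Fixpoint revpart (b : series) (j : nat) (s : word) : rat :=
  match s with
  | [::] => 0
  | false :: s' => revpart b j.+1 s'
  | true :: s' => - b (nseq j.+1 false ++ rev s')
  end.

Definition partner (b : series) : series := fun w => revpart b 0 (rev w).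

Lemma partner_y b u : partner b (rcons u true) = - b (false :: u).
Proof. by rewrite /partner rev_rcons /= revK. Qed.

Lemma partner_x b u : partner b (false :: u) = partner b (rcons u false).
Proof.
rewrite /partner rev_cons rev_rcons /=; move: (rev u) => s.
elim: s 0%N => [|[] s IH] j //=; rewrite rev_rcons.
by rewrite nseq_catr.
Qed.

Lemma partner_yl b u : push_sym b -> partner b (true :: u) = - b (rcons u false).
Proof.
move=> pb; rewrite /partner rev_cons -{2}(revK u); move: (rev u) => s.
suff H j : revpart b j (rcons s true) = - b (rev s ++ nseq j.+1 false) by rewrite H cats1.
elim: s j => [|[] s IH] j; rewrite [LHS]/=.
- by rewrite cats0.
- by rewrite rev_rcons rev_cons cat_rcons -pb.
by rewrite IH rev_cons cat_rcons.
Qed.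

(** The four conditions are the coefficients of the relation at words of length at least 2, sorted
    by first and last letter. At shorter words the relation is an identity. *)
Lemma partner_relP b a : (forall w, sadd (sbr b Y) (sbr X a) w = 0) <->
  [/\ forall u, b (true :: u) = b (rcons u true),
      forall u, a (rcons u true) = - b (false :: u),
      forall u, a (true :: u) = - b (rcons u false) &
      forall u, a (false :: u) = a (rcons u false)].
Proof.
have E c u d : sadd (sbr b Y) (sbr X a) (c :: rcons u d) =
    (d == true)%:R * b (c :: u) - (c == true)%:R * b (rcons u d) +
    ((c == false)%:R * a (rcons u d) - (d == false)%:R * a (c :: u)).
  by rewrite /sadd /sbr !smul_letterl -rcons_cons !smul_letterr_rcons.
split=> [H|[H1 H2 H3 H4] w].
  by split=> u; [have := H (true :: rcons u true)|have := H (false :: rcons u true)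
    |have := H (true :: rcons u false)|have := H (false :: rcons u false)];
    rewrite E /=; lra.
case: w => [|c w]; first by rewrite /sadd /sbr !smul_nil /X /Y /mon; ring.
case/lastP: w => [|u d]; last first.
  rewrite E; case: c d => [] [] /=;
  [have := H1 u|have := H3 u|have := H2 u|have := H4 u]; lra.
rewrite /sadd /sbr !smul_letterl -[[:: c]]/(rcons [::] c) !smul_letterr_rcons.
ring.
Qed.

Lemma word_split_y (u : word) : u = nseq (size u) false \/
  exists i u1, u = nseq i false ++ true :: u1.
Proof.
elim: u => [|[] u IH]; first by left.
  by right; exists 0%N, u.
case: IH => [uE|[i [u1 uE]]]; first by left; rewrite /= -uE.
by right; exists i.+1, u1; rewrite /= -uE.
Qed.

(** The hypothesis moves one block x^i to the other end. The cyclic group permuting the blocks is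
    generated by this shift, so peeling the blocks of [u] one at a time gives the general
    exchange. *)
Lemma push_symP b :
  (forall i V, b (nseq i false ++ true :: V) = b (V ++ true :: nseq i false)) ->
  push_sym b.
Proof.
move=> base u; have [n] := ubnP (size u); elim: n u => // n IH u; rewrite ltnS => su v.
case: (word_split_y u) => [->|[i [u1 uE]]]; first exact: base.
rewrite uE -catA cat_cons base -catA cat_cons IH.
  by rewrite -catA cat_cons.
by apply: leq_trans su; rewrite uE size_cat /= addnS ltnS leq_addl.
Qed.

(** The coefficients of [a] mediate: b(x^(i+1) y V) = - a(x^i y V y) = - a(y V y x^i) = b(V y
    x^(i+1)), the middle equality because [a] lets powers of x pass from one end to the other. *)
Lemma push_sym_of_partner b a :
  (forall w, sadd (sbr b Y) (sbr X a) w = 0) -> push_sym b.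
Proof.
case/partner_relP => [H1 H2 H3 H4].
have ax i t : a (nseq i false ++ t) = a (t ++ nseq i false).
  elim: i t => [|i IH] t; first by rewrite cats0.
  by rewrite [LHS]H4 -cats1 -catA IH -catA.
apply: push_symP => i V.
case: i => [|i]; first by rewrite /= H1 cats1.
rewrite [LHS](_ : _ = - a (rcons (nseq i false ++ true :: V) true)); last first.
  by rewrite H2 opprK.
rewrite rcons_cat ax rcons_cons cat_cons cat_rcons H3 opprK.
by rewrite rcons_cat rcons_cons rcons_nseq.
Qed.

Lemma partner_rel b : push_sym b ->
  forall w, sadd (sbr b Y) (sbr X (partner b)) w = 0.
Proof.
move=> pb; apply/partner_relP; split=> u.
- by have := pb [::] u; rewrite cats1.
- exact: partner_y.
- exact: partner_yl.
exact: partner_x.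
Qed.

Lemma no_depth0_partner b : no_depth0 (partner b).
Proof.
move=> w; rewrite /partner -[depth w]/(count id w) -count_rev; move: (rev w) => s.
suff H j : count id s = 0%N -> revpart b j s = 0 by exact: H.
by elim: s j => [|[] s IH] j //= e; apply: IH.
Qed.

Lemma sadd_eq0 f g : (forall w, sadd f g w = 0) -> f = sscale (-1) g.
Proof.
by move=> H; apply: functional_extensionality => w; move: (H w); rewrite /sadd /sscale; lra.
Qed.

Lemma lieC_partner b : lieC b -> push_sym b -> lieC (partner b).
Proof.
move=> /lieCP [pb _] sb; apply/lieCP; split; last exact: no_depth0_partner.
apply: primitive_of_sbrX; first exact: no_depth0_partner.
have -> : sbr X (partner b) = sscale (-1) (sbr b Y).
  by apply: sadd_eq0 => w; rewrite -[RHS](partner_rel sb w) /sadd addrC.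
by apply: primitiveZ; apply: primitive_sbr => //; apply: primitive_letter.
Qed.

(** Trailing x's are carried to the front until the word ends in y, where the coefficient is
    dictated by [b]. Only powers of x escape this, and there both series vanish. *)
Lemma partner_uniq b a a' : no_depth0 a -> no_depth0 a' ->
  (forall w, sadd (sbr b Y) (sbr X a) w = 0) ->
  (forall w, sadd (sbr b Y) (sbr X a') w = 0) -> a' = a.
Proof.
move=> a0 a0' /partner_relP [_ H2 _ H4] /partner_relP [_ H2' _ H4'].
apply: functional_extensionality => w; have [n] := ubnP (find id (rev w)).
elim: n w => // n IH w; case/lastP: w => [|u [|]]; first by rewrite a0 ?a0'.
  by rewrite H2 H2'.
rewrite rev_rcons /= ltnS => un; rewrite -H4 -H4'.
have [|du] := posnP (depth u); first by move=> du; rewrite a0 ?a0'.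
apply: IH; rewrite rev_cons -cats1 find_cat has_count count_rev -/(depth u) du.
exact: un.
Qed.

(** * Traces *)

Definition cyclic (phi : word -> rat) := forall u v, phi (u ++ v) = phi (v ++ u).

(* [f] vanishes in the space of cyclic words. *)
Definition trace0 (f : series) := forall phi, cyclic phi ->
  forall n, \sum_(w <- words n) f w * phi w = 0.

Lemma trace0D f g : trace0 f -> trace0 g -> trace0 (sadd f g).
Proof.
move=> tf tg phi cphi n; under eq_words => w _ do rewrite /sadd mulrDl.
by rewrite big_split tf // tg // addr0.
Qed.

Lemma trace0Z c f : trace0 f -> trace0 (sscale c f).
Proof.
move=> tf phi cphi n; under eq_words => w _ do rewrite /sscale -mulrA.
by rewrite -mulr_sumr tf // mulr0.
Qed.

Lemma trace_smulC f g phi n : cyclic phi ->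
  \sum_(w <- words n) smul f g w * phi w = \sum_(w <- words n) smul g f w * phi w.
Proof.
move=> cphi; rewrite !sum_smul [LHS]sum_pairsC.
do 3![apply: eq_bigr => ? _]; rewrite cphi; congr (_ * _); exact: mulrC.
Qed.

Lemma trace0_sbr f g : trace0 (sbr f g).
Proof.
move=> phi cphi n; under eq_words => w _ do rewrite /sbr mulrBl.
by rewrite sumrB trace_smulC // subrr.
Qed.

(** The transpose of a derivation maps cyclic functionals to cyclic functionals: psi(uv) = phi(D(u)
    v) + phi(u D(v)) is symmetric under exchange of u and v. *)
Lemma trace0_der b a g : trace0 g -> trace0 (der b a g).
Proof.
move=> tg phi cphi n.
under eq_words => v sv do rewrite derE sv mulr_suml.
rewrite exchange_big big1 // => k _ /=.
pose psi w := \sum_(v <- words n) der_word b a w v * phi v.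
rewrite -[RHS](tg psi _ k).
  under eq_words => v _ do rewrite mulr_suml.
  rewrite exchange_big; apply: eq_words => w _ /=.
  by rewrite /psi mulr_sumr; apply: eq_words => v _; rewrite mulrA.
move=> u v; rewrite /psi !der_word_cat.
under eq_words => w _ do rewrite /sadd mulrDl.
under [RHS]eq_words => w _ do rewrite /sadd mulrDl.
rewrite !big_split /= trace_smulC // addrC; congr (_ + _).
exact: trace_smulC.
Qed.

(** * Bihomogeneous series and the powers of [x,y] *)

Definition bihomog p d (f : series) := forall w, f w != 0 -> size w = p /\ depth w = d.

Lemma bihomog_smul p d p' d' f g : bihomog p d f -> bihomog p' d' g ->
  bihomog (p + p') (d + d') (smul f g).
Proof.
move=> hf hg w; rewrite /smul.
have [/existsP[i]|/existsPn H] := boolP [exists i : 'I_(size w).+1,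
    f (take i w) * g (drop i w) != 0]; last first.
  by rewrite big1 ?eqxx // => i _; apply/eqP; rewrite -[_ == _]negbK.
rewrite mulf_eq0 negb_or => /andP[/hf [s1 d1] /hg [s2 d2]] _.
by rewrite -(cat_take_drop i w) size_cat depth_cat s1 s2 d1 d2.
Qed.

Lemma bihomog_sbr p d p' d' f g : bihomog p d f -> bihomog p' d' g ->
  bihomog (p + p') (d + d') (sbr f g).
Proof.
move=> hf hg w; rewrite /sbr.
have [z1|nz _] := eqVneq (smul f g w) 0; last exact: (bihomog_smul hf hg).
by rewrite z1 sub0r oppr_eq0 => /(bihomog_smul hg hf); rewrite addnC (addnC d').
Qed.

Lemma bihomog_mon u : bihomog (size u) (depth u) (mon u).
Proof. by move=> w; rewrite /mon; case: (w =P u) => [->|_]; rewrite ?eqxx. Qed.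

Lemma bihomog_Cgen i : (0 < i)%N -> bihomog i 1 (Cgen i).
Proof.
case: i => // i _; elim: i => [|i IH]; first exact: (bihomog_mon (u := [:: true])).
exact: (bihomog_sbr (bihomog_mon (u := [:: false])) IH).
Qed.

Lemma bihomog_Cprod s : all (fun i => 0 < i)%N s -> bihomog (sumn s) (size s) (Cprod s).
Proof.
elim: s => [|i s IH] /=; first by move=> _; apply: (bihomog_mon (u := [::])).
move=> /andP[i0 /IH Hs]; rewrite -add1n; exact: bihomog_smul (bihomog_Cgen i0) Hs.
Qed.

(** The power [x,y]^r, since C_2 = [x,y]; written as a product of C_i so that [wval_Cprod] evaluates
    it. *)
Definition brXYpow r := Cprod (nseq r 2).

Lemma bihomog_brXYpow r : bihomog (2 * r) r (brXYpow r).
Proof.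
have := @bihomog_Cprod (nseq r 2); rewrite sumn_nseq size_nseq; apply.
by rewrite all_nseq orbT.
Qed.

(* The series [\sum_r m_r [x,y]^r]. *)
Definition brXYser (m : nat -> rat) : series :=
  fun w => m (size w)./2 * brXYpow (size w)./2 w.

Lemma brXYpow0 r w : size w <> (2 * r)%N \/ depth w <> r -> brXYpow r w = 0.
Proof.
move=> H; apply/eqP; apply: contraT => /bihomog_brXYpow [sw dw].
by case: H.
Qed.

Lemma brXYserE m N w : (size w <= N)%N ->
  brXYser m w = \sum_(r <- iota 0 N.+1) m r * brXYpow r w.
Proof.
move=> sN; have hin : (size w)./2 \in iota 0 N.+1.
  by rewrite mem_iota add0n ltnS (leq_trans _ sN) // leq_half_double; lia.
rewrite /brXYser (bigD1_seq _ hin) ?iota_uniq // big1 /= ?addr0 // => r nr.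
rewrite brXYpow0 ?mulr0 //; left=> sw.
by case/eqP: nr; rewrite sw mul2n doubleK.
Qed.

Lemma der_sum b a (I : Type) (s : seq I) (c : I -> rat) (D : I -> series) :
  der b a (fun w => \sum_(i <- s) c i * D i w) =
  fun w => \sum_(i <- s) c i * der b a (D i) w.
Proof.
elim: s => [|i s IH]; apply: functional_extensionality => t.
  rewrite big_nil (_ : (fun _ => _) = szero) ?der0 //.
  by apply: functional_extensionality => w; rewrite big_nil.
have -> : (fun w => \sum_(j <- i :: s) c j * D j w) =
    sadd (sscale (c i) (D i)) (fun w => \sum_(j <- s) c j * D j w).
  by apply: functional_extensionality => w; rewrite big_cons.
by rewrite derD derZ IH /sadd /sscale big_cons.
Qed.

Lemma der_XY b a : b [::] = 0 -> a [::] = 0 ->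
  (forall w, sadd (sbr b Y) (sbr X a) w = 0) -> der b a (sbr X Y) = szero.
Proof.
move=> b0 a0 H; rewrite der_sbr // (der_letter b0 a0 false) (der_letter b0 a0 true).
by apply: functional_extensionality => w; apply: H.
Qed.

Lemma der_brXYser b a m : b [::] = 0 -> a [::] = 0 ->
  (forall w, sadd (sbr b Y) (sbr X a) w = 0) -> der b a (brXYser m) = szero.
Proof.
move=> b0 a0 H; have powE r : der b a (brXYpow r) = szero.
  elim: r => [|r IH].
    apply: functional_extensionality => v; rewrite der_rec //.
    have z l : lquot l (mon [::]) = szero by [].
    by rewrite !z !smul0r addr0; case: v => [|l v]; rewrite ?addr0 // z der0 addr0.
  rewrite /brXYpow /= der_smul // -/(brXYpow r) IH [Cgen 2]/= der_XY //.
  by rewrite smul0l smul0r; apply: functional_extensionality => w; rewrite /sadd addr0.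
apply: functional_extensionality => v.
rewrite (@der_local _ _ _ _ v (fun w sw => brXYserE m sw)) der_sum.
by rewrite big1 // => r _; rewrite powE mulr0.
Qed.

(** * Right quotients and the divergence cocycle *)

Lemma rquot_smul l f g :
  rquot l (smul f g) = sadd (sscale (g [::]) (rquot l f)) (smul f (rquot l g)).
Proof.
by apply: functional_extensionality => w; rewrite /rquot smul_rcons /sadd /sscale mulrC.
Qed.

Lemma rquot_letter l c : rquot l (letter_series c) = sscale (l == c)%:R (mon [::]).
Proof.
apply: functional_extensionality => w.
by rewrite -(smul1l (letter_series c)) /rquot smul_letterr_rcons.
Qed.

Lemma rquotD l f g : rquot l (sadd f g) = sadd (rquot l f) (rquot l g).
Proof. by []. Qed.

Lemma series_rquot f : f [::] = 0 ->
  f = sadd (smul (rquot false f) X) (smul (rquot true f) Y).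
Proof.
move=> f0; apply: functional_extensionality => w; rewrite /sadd.
case/lastP: w => [|w l]; first by rewrite !smul_letterr_nil addr0.
by rewrite !smul_letterr_rcons /rquot; case: l; rewrite ?mul0r ?mul1r ?addr0 ?add0r.
Qed.

(** A chain rule, obtained by applying D to f = f_x x + f_y y; the right quotients of [b] and [a]
    form the Jacobian matrix of D. *)
Lemma rquot_der b a l f : b [::] = 0 -> a [::] = 0 -> f [::] = 0 ->
  rquot l (der b a f) = sadd (der b a (rquot l f))
    (sadd (smul (rquot false f) (rquot l b)) (smul (rquot true f) (rquot l a))).
Proof.
move=> b0 a0 f0; rewrite {1}(series_rquot f0) derD !der_smul //.
rewrite (der_letter b0 a0 false) (der_letter b0 a0 true) !rquotD !rquot_smul b0 a0.
rewrite !rquot_letter !smulZr !smul1r.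
apply: functional_extensionality => w; rewrite /sadd /sscale /X /Y /mon.
by case: l => /=; ring.
Qed.

Definition divergence (b a : series) := sadd (rquot false b) (rquot true a).

(** By the chain rule the discrepancy is the trace of J'J - JJ' for the two Jacobian matrices, that
    is, a sum of four commutators of their entries. *)
Lemma divergence_cocycle b a b' a' :
  b [::] = 0 -> a [::] = 0 -> b' [::] = 0 -> a' [::] = 0 ->
  trace0 (sadd (divergence (sadd (der b a b') (sscale (-1) (der b' a' b)))
                           (sadd (der b a a') (sscale (-1) (der b' a' a))))
    (sscale (-1) (sadd (der b a (divergence b' a'))
                       (sscale (-1) (der b' a' (divergence b a)))))).
Proof.
move=> b0 a0 b0' a0'.
rewrite [X in trace0 X](_ : _ =
  sadd (sadd (sbr (rquot false b') (rquot false b)) (sbr (rquot true b') (rquot false a)))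
       (sadd (sbr (rquot false a') (rquot true b)) (sbr (rquot true a') (rquot true a)))).
  by do 2!apply: trace0D; apply: trace0_sbr.
have rZ l c f : rquot l (sscale c f) = sscale c (rquot l f) by [].
rewrite /divergence !(rquotD, rZ) !rquot_der // !derD.
by apply: functional_extensionality => w; rewrite /sadd /sscale /sbr; ring.
Qed.

(* Since [partner b (w y) = - b (x w)], this is the divergence of [D_{b,a}]. *)
Definition pdiv (b : series) : series := fun w => b (rcons w false) - b (false :: w).

Lemma pdivE b a : (forall w, sadd (sbr b Y) (sbr X a) w = 0) -> pdiv b = divergence b a.
Proof.
case/partner_relP => _ H2 _ _; apply: functional_extensionality => w.
by rewrite /divergence /sadd /rquot H2.
Qed.

(** * The space described by coefficients of words, and its stability under the bracket *)

Definition div_cond (b : series) :=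
  exists m, trace0 (sadd (pdiv b) (sscale (-1) (brXYser m))).

Definition krvw b := [/\ lieC b, push_sym b & div_cond b].

Lemma der_comm b a b' a' f : primitive b -> primitive a ->
  primitive b' -> primitive a' -> lie2 f ->
  forall w, der b a (der b' a' f) w - der b' a' (der b a f) w =
   der (sadd (der b a b') (sscale (-1) (der b' a' b)))
       (sadd (der b a a') (sscale (-1) (der b' a' a))) f w.
Proof.
move=> pb pa pb' pa' lf w.
have b0 := primitive_nil pb; have a0 := primitive_nil pa.
have b0' := primitive_nil pb'; have a0' := primitive_nil pa'.
have [p [sp fp]] := lie2_approx (size w) lf.
have dd c d c' d' : der c d (der c' d' f) w = der c d (der c' d' p) w.
  by apply: der_local => v vw; apply: der_local => u uv; apply: fp; apply: leq_trans vw.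
rewrite !dd [in RHS](der_local _ _ fp); move: {dd fp} w.
set c := sadd _ _; set d := sadd _ (sscale _ (der b' a' a)).
have c0 : c [::] = 0.
  by apply: primitive_nil; apply: primitiveD; [|apply: primitiveZ]; apply: primitive_der.
have d0 : d [::] = 0.
  by apply: primitive_nil; apply: primitiveD; [|apply: primitiveZ]; apply: primitive_der.
elim: sp => [s [] ->||g h _ Hg _ Hh|k g _ Hg|g h _ Hg _ Hh] w.
- rewrite (der_letter b0 a0 false) (der_letter b0' a0' false) (der_letter c0 d0 false).
  by rewrite /c /sadd /sscale; ring.
- rewrite (der_letter b0 a0 true) (der_letter b0' a0' true) (der_letter c0 d0 true).
  by rewrite /d /sadd /sscale; ring.
- by rewrite !der0 subrr.
- by rewrite !derD /sadd -Hg -Hh; ring.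
- by rewrite !derZ /sscale -Hg; ring.
have Eg : der c d g = sadd (der b a (der b' a' g)) (sscale (-1) (der b' a' (der b a g))).
  by apply: functional_extensionality => v; rewrite -Hg /sadd /sscale; ring.
have Eh : der c d h = sadd (der b a (der b' a' h)) (sscale (-1) (der b' a' (der b a h))).
  by apply: functional_extensionality => v; rewrite -Hh /sadd /sscale; ring.
rewrite !(der_sbr, derD) // Eg Eh !(sbrDl, sbrDr, sbrZl, sbrZr) /sadd /sscale.
ring.
Qed.

Lemma krvw_bracket b a b' a' : krvw b -> lieC a ->
  (forall w, sadd (sbr b Y) (sbr X a) w = 0) -> krvw b' -> lieC a' ->
  (forall w, sadd (sbr b' Y) (sbr X a') w = 0) ->
  let c := sadd (der b a b') (sscale (-1) (der b' a' b)) in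
  let d := sadd (der b a a') (sscale (-1) (der b' a' a)) in
  [/\ krvw c, lieC d & forall w, sadd (sbr c Y) (sbr X d) w = 0].
Proof.
move=> [/lieCP[pb bx] sb [m Tm]] /lieCP[pa ax] ab [/lieCP[pb' bx'] sb' [m' Tm']].
move=> /lieCP[pa' ax'] ab' c d.
have b0 := primitive_nil pb; have a0 := primitive_nil pa.
have b0' := primitive_nil pb'; have a0' := primitive_nil pa'.
have lC e f g : primitive e -> primitive f -> lieC g ->
    e [:: false] = 0 -> f [:: false] = 0 -> lieC (der e f g).
  move=> pe pf /lieCP[pg gx] ex fx; apply/lieCP; split; first exact: primitive_der.
  have e0 := primitive_nil pe; have f0 := primitive_nil pf.
  rewrite der_rec // !smul_cons !smul_nil /lquot e0 f0 ex fx !mul0r !addr0 !add0r.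
  by rewrite der_rec // !smul_nil e0 f0 !mul0r !addr0.
have lDZ f g : lieC f -> lieC g -> lieC (sadd f (sscale (-1) g)).
  move=> /lieCP[pf fx] /lieCP[pg gx]; apply/lieCP; split.
    by apply: primitiveD => //; apply: primitiveZ.
  by rewrite /sadd /sscale fx gx mulr0 addr0.
have Cb : lieC b by apply/lieCP.
have Cb' : lieC b' by apply/lieCP.
have Ca : lieC a by apply/lieCP.
have Ca' : lieC a' by apply/lieCP.
(* Each derivation is applied to the relation satisfied by the other pair. The cross terms [b',a] +
   [b,a'] are the same in both results and cancel in the difference. *)
have rel w : sadd (sbr c Y) (sbr X d) w = 0.
  have E e f e' f' : e [::] = 0 -> f [::] = 0 ->
      (forall v, sadd (sbr e' Y) (sbr X f') v = 0) ->
      sadd (sadd (sbr (der e f e') Y) (sbr e' f)) (sadd (sbr e f') (sbr X (der e f f'))) w = 0.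
    move=> e0 f0 H.
    have := congr1 (fun g => der e f g w) (functional_extensionality _ szero H).
    by rewrite derD !der_sbr // der0 (der_letter e0 f0 false) (der_letter e0 f0 true).
  have := E _ _ _ _ b0 a0 ab'; have := E _ _ _ _ b0' a0' ab.
  rewrite /c /d !(sbrDl, sbrDr, sbrZl, sbrZr) /sadd /sscale; lra.
have Cc : lieC c by apply: lDZ; apply: lC.
have Cd : lieC d by apply: lDZ; apply: lC.
split=> //; split=> //; first exact: push_sym_of_partner rel.
(* All constants of a bracket are zero: each divergence is a sum of multiples of [x,y]^r modulo
   commutators, and the other derivation kills these powers. *)
exists (fun _ => 0); rewrite (pdivE rel).
have -> : brXYser (fun _ => 0) = szero.
  by apply: functional_extensionality => w; rewrite /brXYser mul0r.
have T e f e' k : e [::] = 0 -> f [::] = 0 ->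
    (forall v, sadd (sbr e Y) (sbr X f) v = 0) ->
    trace0 (sadd (pdiv e') (sscale (-1) (brXYser k))) -> trace0 (der e f (pdiv e')).
  move=> e0 f0 H /(@trace0_der e f); rewrite derD derZ der_brXYser //.
  rewrite (_ : sadd _ (sscale _ szero) = der e f (pdiv e')) //.
  by apply: functional_extensionality => w; rewrite /sadd /sscale mulr0 addr0.
rewrite [X in trace0 X](_ : _ = sadd (sadd (divergence c d)
    (sscale (-1) (sadd (der b a (pdiv b')) (sscale (-1) (der b' a' (pdiv b))))))
    (sadd (der b a (pdiv b')) (sscale (-1) (der b' a' (pdiv b))))).
  apply: trace0D; last first.
    by apply: trace0D; [exact: T Tm'|apply: trace0Z; exact: T Tm].
  rewrite (pdivE ab) (pdivE ab'); exact: divergence_cocycle.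
by apply: functional_extensionality => w; rewrite /sadd /sscale /szero; ring.
Qed.

(** * Generating polynomials of series *)

(* The monomial [z_0^(a_0) ... z_r^(a_r)] of the word [x^(a_0) y x^(a_1) ... y x^(a_r)]. *)
Fixpoint mval (w : word) (z : seq rat) : rat :=
  match w with
  | [::] => 1
  | false :: w' => head 0 z * mval w' z
  | true :: w' => mval w' (behead z)
  end.

Definition wval n (f : series) z := \sum_(w <- words n) f w * mval w z.

Lemma mval_cat u v z : mval (u ++ v) z = mval u z * mval v (drop (depth u) z).
Proof.
elim: u z => [|[] u IH] z /=; first by rewrite mul1r drop0.
  by rewrite IH /depth /= add1n -drop1 drop_drop addn1.
by rewrite IH mulrA.
Qed.

Lemma eq_mval w z z' : (forall i, (i <= depth w)%N -> nth 0 z i = nth 0 z' i) ->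
  mval w z = mval w z'.
Proof.
elim: w z z' => [|[] w IH] z z' H //=.
  by apply: IH => i iw; rewrite !nth_behead; apply: H.
by rewrite -!nth0 H // (IH z z').
Qed.

Lemma smul_bihomog p d f g u v : bihomog p d f -> size u = p ->
  smul f g (u ++ v) = f u * g v.
Proof.
move=> hf su.
have pi : (p < (size (u ++ v)).+1)%N by rewrite size_cat su ltnS leq_addr.
rewrite /smul (bigD1 (Ordinal pi)) //= take_size_cat // drop_size_cat // big1 ?addr0 //.
move=> i ni; have [->|/hf [si _]] := eqVneq (f (take i (u ++ v))) 0; first by rewrite mul0r.
case/eqP: ni; apply: val_inj => /=.
by rewrite -si size_takel // -ltnS.
Qed.

(** The last block of x's of the left factor merges with the first block of the right one, so the
    two share z_d; hence [drop d] and not [drop d.+1]. *)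
Lemma wval_smul p d n f g z : bihomog p d f ->
  wval (p + n) (smul f g) z = wval p f z * wval n g (drop d z).
Proof.
move=> hf; rewrite /wval sum_words_cat mulr_suml; apply: eq_words => u su.
rewrite mulr_sumr; apply: eq_words => v _; rewrite (smul_bihomog _ _ hf) // mval_cat.
have [->|/hf [_ ->]] := eqVneq (f u) 0; first by rewrite !mul0r.
by rewrite mulrACA.
Qed.

Lemma wval_sub n f g z : wval n (fun w => f w - g w) z = wval n f z - wval n g z.
Proof. by rewrite /wval -sumrB; apply: eq_words => w _; rewrite mulrBl. Qed.

Lemma wval_letter l z : wval 1 (letter_series l) z = if l then 1 else head 0 z.
Proof.
rewrite /wval sum_wordsS !sum_words0 /letter_series /mon /=.
by case: l => /=; rewrite ?mul0r ?mul1r ?mulr1 ?addr0 ?add0r.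
Qed.

Lemma wval_Cgen i z : (0 < i)%N ->
  wval i (Cgen i) z = (head 0 z - head 0 (behead z)) ^+ i.-1.
Proof.
case: i => // i _; elim: i => [|i IH]; first exact: (wval_letter true).
rewrite exprS -[i.+1 in LHS]/(i.+2.-1) [LHS]wval_sub.
rewrite -[i.+2]add1n (wval_smul _ _ _ (bihomog_mon (u := [:: false]))) drop0.
rewrite (wval_letter false) IH add1n -addn1.
rewrite (wval_smul _ _ _ (bihomog_Cgen (ltn0Sn i))) IH (wval_letter false) /= drop1.
by rewrite addn1 /= mulrBl [_ ^+ _ * _]mulrC.
Qed.

Lemma wval_Cprod s z : all (fun i => 0 < i)%N s ->
  wval (sumn s) (Cprod s) z =
  \prod_(j < size s) (nth 0 z j - nth 0 z j.+1) ^+ (nth 0%N s j).-1.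
Proof.
elim: s z => [|i s IH] z /=.
  by move=> _; rewrite big_ord0 /wval sum_words0 /mon /= mulr1.
move=> /andP[i0 s0]; rewrite big_ord_recl.
rewrite (wval_smul _ _ _ (bihomog_Cgen i0)) wval_Cgen // IH // -nth0 -nth0 nth_behead.
congr (_ * _); apply: eq_bigr => j _.
by rewrite drop1 !nth_behead.
Qed.

Lemma is_compP r n (s : r.-tuple 'I_n.+1) : is_comp s ->
  all (fun i => 0 < i)%N (map val s) /\ sumn (map val s) = n.
Proof. by case/andP=> h /eqP; rewrite all_map. Qed.

(* Replacing [C_i] by [(z_(j-1) - z_j)^(i-1)] turns [b] into [B]: the variables are related
   by [u_j = z_(j-1) - z_j]. *)
Lemma Bpol_wval b k r n (v : 'I_r -> rat) z : Cexp b k ->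
  (forall j : 'I_r, v j = nth 0 z j - nth 0 z j.+1) ->
  (Bpol k r n).@[v] = wval n (dp_part r b) z.
Proof.
move=> bk vz; rewrite /wval.
transitivity (\sum_(w <- words n) wt_part n (dp_part r b) w * mval w z); last first.
  by apply: eq_words => w sw; rewrite /wt_part sw eqxx.
under eq_words => w _ do rewrite bk mulr_suml.
rewrite exchange_big /Bpol raddf_sum; apply: eq_bigr => s /is_compP [s0 sn] /=.
under eq_words => w _ do rewrite -mulrA.
rewrite -mulr_sumr -[X in \sum_(w <- words X) _]sn -/(wval _ _ _) wval_Cprod //.
rewrite mevalZ rmorph_prod size_map size_tuple; congr (_ * _); apply: eq_bigr => j _.
rewrite rmorphXn /= mevalXU vz (nth_map ord0) ?size_tuple //.
by rewrite (tnth_nth ord0).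
Qed.

(** * Polynomials determined by their values at rational points *)

Lemma poly_eq0_off (s : seq rat) (p : {poly rat}) :
  (forall t, t \notin s -> p.[t] = 0) -> p = 0.
Proof.
move=> H; pose q := p * \prod_(a <- s) ('X - a%:P).
have q0 : q = 0.
  apply/eqP; apply: contraT => nq.
  have := max_poly_roots nq (rs := [seq i.+1%:R | i <- iota 0 (size q)]).
  rewrite size_map size_iota ltnn; apply.
    apply/allP => t _; apply/eqP; rewrite hornerM.
    have [ts|/H->] := boolP (t \in s); last by rewrite mul0r.
    by rewrite horner_prod (big_rem t) //= hornerXsubC subrr mul0r mulr0.
  rewrite map_inj_uniq ?iota_uniq // => i j /eqP.
  by rewrite Num.Theory.eqr_nat eqSS => /eqP.
by move/eqP: q0; rewrite mulf_eq0 (negbTE (monic_neq0 (monic_prod_XsubC s _ id))) orbF => /eqP.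
Qed.

Fixpoint mpol (w : word) (z : seq rat) : {poly rat} :=
  match w with
  | [::] => 1
  | false :: w' => 'X * mpol w' z
  | true :: w' => (mval w' z)%:P
  end.

Lemma mpolE w z t : (mpol w z).[t] = mval w (t :: z).
Proof.
elim: w => [|[] w IH] /=; first by rewrite hornerC.
  by rewrite hornerC.
by rewrite hornerM hornerX IH.
Qed.

(** Distinct non-zero entries are the points where the denominators met later do not vanish.
    Induction on the length: as a polynomial in its first variable, the value has the words
    beginning with y as constant term, and the words beginning with x give a multiple of that
    variable. *)
Lemma wval_inj n r g :
  (forall z, size z = r.+1 -> uniq (0 :: z) -> wval n (dp_part r g) z = 0) ->
  forall w, size w = n -> depth w = r -> g w = 0.
Proof.
pose P n r g z : {poly rat} := \sum_(w <- words n) dp_part r g w *: mpol w z.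
have PE m s h z t : (P m s h z).[t] = wval m (dp_part s h) (t :: z).
  by rewrite horner_sum; apply: eq_words => w _; rewrite hornerZ mpolE.
have ucons t z : t \notin 0 :: z -> uniq (0 :: z) -> uniq (0 :: t :: z).
  by rewrite /= !inE !negb_or eq_sym => /andP[-> ->] /andP[-> ->].
suff main : forall m s h, (forall z, size z = s -> uniq (0 :: z) ->
    P m s h z = 0) -> forall w, size w = m -> depth w = s -> h w = 0.
  move=> H; apply: main => z sz uz; apply: (@poly_eq0_off (0 :: z)) => t tz.
  by rewrite PE H ?ucons //= ?sz.
elim=> [|m IH] s h H w.
  move=> /size0nil -> ds; subst s; have := H [::] erefl erefl.
  by rewrite /P sum_words0 /dp_part eqxx alg_polyC => /eqP; rewrite polyC_eq0 => /eqP.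
have split z : P m.+1 s h z = 'X * P m s (lquot false h) z +
    (\sum_(w <- words m) dp_part s h (true :: w) * mval w z)%:P.
  rewrite /P sum_wordsS mulr_sumr; congr (_ + _).
    by apply: eq_big_seq => u _; rewrite -scalerAr.
  rewrite rmorph_sum; apply: eq_big_seq => u _ /=.
  by rewrite -mul_polyC rmorphM.
have H2 z : size z = s -> uniq (0 :: z) ->
   P m s (lquot false h) z = 0 /\ \sum_(w <- words m) dp_part s h (true :: w) * mval w z = 0.
  move=> sz nz; have := H z sz nz; rewrite split => e.
  have c0 := congr1 (fun p : {poly rat} => p`_0) e.
  move: c0; rewrite /= coefD coefXM coefC coef0 add0r /= => c0; split=> //.
  by apply/eqP; move/eqP: e; rewrite c0 addr0 mulf_eq0 polyX_eq0.
case: w => // [[] w] [sw] dw; last first.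
  by apply: (IH s (lquot false h) _ w) => // z sz nz; have [] := H2 z sz nz.
case: s dw H2 {H split} => // s [dw] H2.
apply: (IH s (lquot true h) _ w) => // z sz uz; apply: (@poly_eq0_off (0 :: z)) => t tz.
have {}uz : uniq (0 :: t :: z) by apply: ucons.
rewrite PE; have [|_ e] := H2 (t :: z) _ uz; first by rewrite /= sz.
rewrite -[RHS]e; by apply: eq_words => u _.
Qed.

Lemma mpoly_eq0 r (p : {mpoly rat[r]}) : (forall v, p.@[v] = 0) -> p = 0.
Proof.
elim: r p => [|r IH] p H.
  have pE : p = (p@_0)%:MP.
    apply/mpolyP => m; rewrite mcoeffC (_ : m = 0%MM) ?eqxx ?mulr1 //.
    by apply/mnmP => -[].
  by have := H (fun _ => 0); rewrite pE mevalC => ->; rewrite mpolyC0.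
pose wd := widen_ord (leqnSn r).
have mE (m m' : 'X_{1.. r.+1}) : m ord_max = m' ord_max ->
    [multinom m' (wd i) | i < r] = [multinom m (wd i) | i < r] -> m = m'.
  move=> e e'; apply/mnmP => i; have [il|ri] := ltnP i r; last first.
    suff -> : i = ord_max by [].
    by apply: val_inj; apply/eqP; rewrite eqn_leq ri -ltnS ltn_ord.
  have := congr1 (fun q : 'X_{1.. r} => q (Ordinal il)) e'; rewrite /= !mnmE.
  by rewrite (_ : wd (Ordinal il) = i) //; apply: val_inj.
(* Isolating the last variable loses no coefficient, so it suffices to show that [muni p] is zero,
   which the induction does coefficient by coefficient. *)
have mc (m : 'X_{1.. r.+1}) : ((muni p)`_(m ord_max))@_[multinom m (wd i) | i < r] = p@_m.
  rewrite muniE coef_sum raddf_sum /=.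
  under eq_bigr => m' _ do rewrite coefZ coefXn [_ * _]mulrC mulr_natl raddfMn /= mcoeffZ mcoeffX.
  have [ms|] := boolP (m \in msupp p); last first.
    move=> ms; rewrite (memN_msupp_eq0 ms) big1_seq // => m' /andP[_ m's].
    case: eqP => [e'|_]; last by rewrite mulr0 mul0rn.
    case: eqP => [e|_]; last by rewrite mulr0n.
    case/negP: ms; suff -> : m = m' by [].
    exact: mE.
  rewrite (bigD1_seq m) ?msupp_uniq //= !eqxx mulr1 mulr1n big1 ?addr0 // => m' nm.
  case: eqP => [e'|_]; last by rewrite mulr0 mul0rn.
  case: eqP => [e|_]; last by rewrite mulr0n.
  by case/eqP: nm; rewrite (mE m m').
suff m0 : muni p = 0.
  by apply/mpolyP => m; rewrite -mc m0 coef0 mcoeff0 mcoeff0.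
apply/polyP => j; rewrite coef0; apply: IH => v.
suff q0 : map_poly (meval v) (muni p) = 0 by rewrite -coef_map q0 coef0.
apply: (@poly_eq0_off [::]) => t _.
pose v' (i : 'I_r.+1) := if insub (i : nat) is Some j then v j else t.
rewrite -[RHS](H v') mevalE muniE raddf_sum horner_sum; apply: eq_bigr => m _ /=.
rewrite map_polyZ map_polyXn hornerZ hornerXn /= mevalZ mevalX -mulrA; congr (_ * _).
rewrite big_ord_recr /=; congr (_ * _).
  apply: eq_bigr => i _; rewrite mnmE /v' /= insubT ?ltn_ord // => ir.
  by congr (v _ ^+ _); apply: val_inj.
by rewrite /v' insubF //= ltnn.
Qed.

(** * Rotations of words *)

(** Cyclic shift of the exponents (a_0, ..., a_r) of x^(a_0) y ... y x^(a_r). Equivalently,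
    [rcons w true] is rotated past its first block, which is why pairings with cyclic functionals at
    [rcons v true] do not see it. *)
Definition rotw (w : word) : word :=
  let i := find id w in
  if (i < size w)%N then drop i.+1 w ++ true :: take i w else w.

Lemma rotw_y i v : rotw (nseq i false ++ true :: v) = v ++ true :: nseq i false.
Proof.
have fi : find id (nseq i false ++ true :: v) = i by elim: i => //= i ->.
rewrite /rotw fi size_cat size_nseq /= -[X in (X < _)%N]addn0 ltn_add2l /=.
rewrite drop_cat take_cat size_nseq ltnn subnn /= cats0.
by rewrite ltnNge leqnSn /= subSn // subnn /= drop0.
Qed.

Lemma rotw_x i : rotw (nseq i false) = nseq i false.
Proof.
have fi : find id (nseq i false) = i by elim: i => //= i ->.
by rewrite /rotw fi size_nseq ltnn.
Qed.

Lemma size_rotw w : size (rotw w) = size w.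
Proof.
case: (word_split_y w) => [->|[i [v ->]]]; rewrite ?rotw_x // rotw_y.
by rewrite !size_cat /= addnC addSnnS.
Qed.

Lemma depth_rotw w : depth (rotw w) = depth w.
Proof.
case: (word_split_y w) => [->|[i [v ->]]]; rewrite ?rotw_x // rotw_y.
rewrite !depth_cat /depth /=; lia.
Qed.

(** Reversing words conjugates the shift of blocks into the opposite shift. *)
Lemma rotwK : cancel rotw (fun w => rev (rotw (rev w))).
Proof.
have rn i : rev (nseq i false) = nseq i false.
  by elim: i => //= i IH; rewrite rev_cons IH rcons_nseq.
move=> w; case: (word_split_y w) => [->|[i [v ->]]].
  by rewrite rotw_x rn rotw_x rn.
by rewrite rotw_y rev_cat rev_cons cat_rcons rn rotw_y rev_cat rev_cons revK cat_rcons rn.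
Qed.

Lemma sum_rotw n (F : word -> rat) :
  \sum_(w <- words n) F (rotw w) = \sum_(w <- words n) F w.
Proof.
rewrite -(big_map rotw xpredT F) /=; apply: perm_big.
have u : uniq (map rotw (words n)).
  by rewrite map_inj_uniq ?words_uniq //; apply: can_inj rotwK.
apply: uniq_perm => //; first exact: words_uniq.
have [||_ e] := uniq_min_size (s2 := words n) u; last exact: e.
  by move=> _ /mapP[w wn ->]; rewrite mem_words size_rotw -mem_words.
by rewrite size_map.
Qed.

Lemma mval_nseq i z : mval (nseq i false) z = head 0 z ^+ i.
Proof. by elim: i => //= i ->; rewrite exprS. Qed.

Lemma mval_rotw w z : size z = (depth w).+1 -> mval (rotw w) (rot 1 z) = mval w z.
Proof.
case: z => // t z [sz]; rewrite rot1_cons.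
case: (word_split_y w) sz => [wE|[i [v ->]]] sz.
  have d0 : depth w = 0%N by rewrite wE /depth count_nseq.
  by move: sz; rewrite d0 wE rotw_x => /size0nil ->.
have dn : depth (nseq i false) = 0%N by rewrite /depth count_nseq.
move: sz; rewrite depth_cat dn -[(_ + _)%N]/((depth v).+1) => sz.
rewrite rotw_y !mval_cat dn drop0 !mval_nseq [RHS]mulrC [mval (true :: _) _]/=.
rewrite [mval (true :: _) _]/=; congr (_ * _).
  by apply: eq_mval => j jv; rewrite nth_rcons sz ltnS jv.
by rewrite mval_nseq -drop1 drop_drop add1n -cats1 -sz drop_size_cat.
Qed.

Lemma dp_part_rotw r g : dp_part r (g \o rotw) = dp_part r g \o rotw.
Proof. by apply: functional_extensionality => w; rewrite /dp_part /= depth_rotw. Qed.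

Lemma wval_rot1 n r g z : size z = r.+1 ->
  wval n (dp_part r g) (rot 1 z) = wval n (dp_part r (g \o rotw)) z.
Proof.
move=> sz; rewrite /wval -sum_rotw; apply: eq_words => w _.
rewrite dp_part_rotw /= /dp_part depth_rotw; case: eqP => [dw|_]; last by rewrite !mul0r.
by rewrite mval_rotw // dw.
Qed.

Lemma wval_rot n r g z i : size z = r.+1 -> (i <= r.+1)%N ->
  wval n (dp_part r g) (rot i z) = wval n (dp_part r (g \o iter i rotw)) z.
Proof.
move=> sz; elim: i g => [|i IH] g ir; first by rewrite rot0.
rewrite rotS ?sz // wval_rot1 ?size_rot // IH ?(ltnW ir) //; congr (wval n (dp_part r _) z).
Qed.

Lemma push_sym_rotw b : push_sym b <-> b \o rotw = b.
Proof.
split=> [pb|bE].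
  apply: functional_extensionality => w; case: (word_split_y w) => [->|[i [v ->]]] /=.
    by rewrite rotw_x.
  by rewrite rotw_y pb.
by apply: push_symP => i V; rewrite -rotw_y -{1}bE.
Qed.

Lemma dp_partB r f g :
  dp_part r (fun w => f w - g w) = fun w => dp_part r f w - dp_part r g w.
Proof.
by apply: functional_extensionality => w; rewrite /dp_part; case: eqP => //; rewrite subrr.
Qed.

Lemma push_sym_wval b : push_sym b <->
  (forall r n z, size z = r.+1 -> wval n (dp_part r b) (rot 1 z) = wval n (dp_part r b) z).
Proof.
split=> [/push_sym_rotw bE r n z sz|H]; first by rewrite wval_rot1 // bE.
apply/push_sym_rotw; apply: functional_extensionality => w /=; apply/eqP.
rewrite -subr_eq0; apply/eqP.
apply: (@wval_inj (size w) (depth w) (fun w => b (rotw w) - b w)) => // z sz _.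
by rewrite dp_partB wval_sub -(wval_rot1 _ b sz) H // subrr.
Qed.

Lemma sum_rotS (V : nmodType) r (F : seq rat -> V) y : size y = r ->
  \sum_(i < r) F (rot i.+1 y) = \sum_(i < r) F (rot i y).
Proof.
case: r => [|r] sy; first by rewrite !big_ord0.
rewrite big_ord_recr big_ord_recl /= rot0 addrC; congr (F _ + _).
by rewrite -sy rot_size.
Qed.

(** On a circle the first and last blocks of a word merge, so their variables are identified.
    Summing over rotations makes the result a cyclic functional on words of depth [r]. *)
Definition closed_mval r (y : seq rat) (w : word) : rat :=
  \sum_(i < r) mval w (rcons (rot i y) (head 0 (rot i y))).

Lemma mval_closed_cat u v y : size y = (depth u + depth v)%N ->
  mval (u ++ v) (rcons y (head 0 y)) =
  mval (v ++ u) (rcons (rot (depth u) y) (head 0 (rot (depth u) y))).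
Proof.
move=> sy; have [p [s [-> sp ss]]] : exists p s,
    [/\ y = p ++ s, size p = depth u & size s = depth v].
  exists (take (depth u) y), (drop (depth u) y); rewrite cat_take_drop size_drop sy addKn.
  by rewrite size_takel // sy leq_addr.
rewrite !mval_cat -sp rot_size_cat -ss -!cats1 -!catA !drop_size_cat // mulrC.
congr (_ * _); apply: eq_mval => i; rewrite -?sp -?ss => ile.
  rewrite !nth_cat; case: ltngtP ile => // ie _; rewrite ie subnn -!nth0.
  by case: p {sy sp} => [|t p] //=; rewrite cats0.
rewrite [LHS]nth_cat [RHS]nth_cat; case: ltngtP ile => // ie _; rewrite ie subnn -!nth0.
by case: s {sy ss} => [|t s] //=; rewrite cats0.
Qed.

Lemma closed_mval_cyclic r y u v : size y = r -> (depth u + depth v)%N = r ->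
  closed_mval r y (u ++ v) = closed_mval r y (v ++ u).
Proof.
move=> sy duv.
pose F w z := mval w (rcons z (head 0 z)).
rewrite /closed_mval -/(F _ _).
have shift k : \sum_(i < r) F (v ++ u) (rot k (rot i y)) = \sum_(i < r) F (v ++ u) (rot i y).
  have [kr|kr] := leqP k r; last first.
    by apply: eq_bigr => i _; rewrite [rot k _]rot_oversize // size_rot sy ltnW.
  elim: k kr => [|k IH] kr; first by apply: eq_bigr => i _; rewrite rot0.
  rewrite -[RHS]IH 1?ltnW // -(sum_rotS (fun z => F _ (rot k z)) sy).
  apply: eq_bigr => i _ /=; congr (F _ _).
  by rewrite (@rotS _ k) ?size_rot ?sy // (@rotS _ i) ?sy // rot_rot.
rewrite -[RHS](shift (depth u)); apply: eq_bigr => i _.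
by rewrite /F [LHS]mval_closed_cat // size_rot sy.
Qed.

(** * The divergence condition on generating polynomials *)

Lemma cyclic_rcons phi l v : cyclic phi -> phi (rcons v l) = phi (l :: v).
Proof. by move=> cphi; rewrite -cats1 cphi. Qed.

Lemma cyclic_depth r phi : cyclic phi -> cyclic (dp_part r phi).
Proof. by move=> cphi u v; rewrite /dp_part !depth_cat addnC cphi. Qed.

Lemma sum_smulY f (phi : word -> rat) M :
  \sum_(w <- words M.+1) smul f Y w * phi w = \sum_(v <- words M) f v * phi (rcons v true).
Proof.
rewrite sum_words_rcons big1 ?add0r => [|v _].
  by apply: eq_words => v _; rewrite smul_letterr_rcons mul1r.
by rewrite smul_letterr_rcons !mul0r.
Qed.

(* Modulo commutators the divergence of [D_{b,a}] is the product of minus this series and [Y]. *)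
Definition pdivY (b : series) : series :=
  fun v => b (true :: false :: v) - b (true :: rcons v false).

(** Splitting off a letter leaves b(y v x) - b(x v y) against phi(y v), the two b(x v x) terms
    cancelling. Push-symmetry turns b(x v y) into b(y x v). *)
Lemma trace_pdiv b phi M : push_sym b -> cyclic phi ->
  \sum_(w <- words M.+1) pdiv b w * phi w =
  - \sum_(v <- words M) pdivY b v * phi (rcons v true).
Proof.
move=> pb cphi; under eq_words => w _ do rewrite /pdiv mulrBl.
rewrite sumrB sum_wordsS sum_words_rcons -!big_split -[RHS]sumrN -sumrB.
apply: eq_words => v _; rewrite /= !cyclic_rcons // /pdivY.
have := pb (false :: v) [::]; rewrite cats1 /= => ->.
ring.
Qed.

(** With P = [x,y]^r, cyclicity turns xyP - yxP into (Px - xP)y. *)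
Lemma trace_brXYpow r phi M : cyclic phi ->
  \sum_(w <- words M.+1) brXYpow r.+1 w * phi w =
  \sum_(v <- words M) sbr (brXYpow r) X v * phi (rcons v true).
Proof.
move=> cphi; rewrite -sum_smulY -[brXYpow r.+1]/(smul (sbr X Y) (brXYpow r)).
rewrite trace_smulC // !sbr_def !(smulDl, smulDr, smulZl, smulZr) !smulA.
under eq_words => w _ do rewrite /sadd /sscale mulrDl -mulrA.
under [RHS]eq_words => w _ do rewrite /sadd /sscale mulrDl -mulrA.
rewrite !big_split -!mulr_sumr; congr (_ + _ * _).
by rewrite trace_smulC // smulA.
Qed.

Lemma brXYser_depth m w : brXYser m w = m (depth w) * brXYpow (depth w) w.
Proof.
rewrite (brXYserE m (leqnn (size w))).
have hin : depth w \in iota 0 (size w).+1 by rewrite mem_iota ltnS count_size.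
rewrite (bigD1_seq _ hin) ?iota_uniq // big1 /= ?addr0 // => r nr.
by rewrite brXYpow0 ?mulr0 //; right=> e; rewrite e eqxx in nr.
Qed.

Definition div_defect b (mr : rat) r : series :=
  fun v => pdivY b v + mr * sbr (brXYpow r) X v.

Lemma trace_depth b m r phi M : push_sym b -> cyclic phi ->
  \sum_(w <- words M.+1) sadd (pdiv b) (sscale (-1) (brXYser m)) w * dp_part r.+1 phi w =
  - \sum_(v <- words M) dp_part r (div_defect b (m r.+1) r) v * phi (rcons v true).
Proof.
move=> pb /(cyclic_depth r.+1) cphi.
transitivity (\sum_(w <- words M.+1) pdiv b w * dp_part r.+1 phi w -
    m r.+1 * \sum_(w <- words M.+1) brXYpow r.+1 w * dp_part r.+1 phi w).
  rewrite mulr_sumr -sumrB; apply: eq_words => w _; rewrite /sadd /sscale brXYser_depth.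
  by rewrite /dp_part; case: eqP => [->|_]; ring.
rewrite trace_pdiv // trace_brXYpow // mulr_sumr -opprD -big_split; congr (- _).
apply: eq_words => v _; rewrite /div_defect /dp_part depth_rcons addn1 eqSS.
by case: eqP => _ /=; ring.
Qed.

Lemma div_condP b : no_depth0 b -> push_sym b -> div_cond b <->
  exists m, forall r M, (0 < r)%N -> forall phi, cyclic phi ->
    \sum_(v <- words M) dp_part r (div_defect b (m r.+1) r) v * phi (rcons v true) = 0.
Proof.
move=> b0 pb; split=> [[m tm]|[m Hm]].
  exists m => r M r0 phi cphi; apply: oppr_inj; rewrite oppr0 -trace_depth //.
  by apply: tm; apply: cyclic_depth.
(* The hypothesis is silent in depths 0 and 1, and there the constant 0 works: the divergence has no
   part of depth 0, and [pdivY] vanishes on powers of x. *)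
pose m' r := if (1 < r)%N then m r else 0.
exists m' => phi cphi n; pose f := sadd (pdiv b) (sscale (-1) (brXYser m')).
rewrite -/f.
have f0 w : depth w = 0%N -> f w = 0.
  move=> dw; rewrite /f /sadd /sscale brXYser_depth dw mul0r mulr0 addr0 /pdiv.
  by rewrite !b0 ?subrr // depth_rcons dw.
transitivity (\sum_(r < n.+1) \sum_(w <- words n) f w * dp_part r phi w).
  rewrite exchange_big; apply: eq_words => w sw /=; rewrite -mulr_sumr; congr (_ * _).
  have dn : (depth w < n.+1)%N by rewrite ltnS -sw count_size.
  rewrite (bigD1 (Ordinal dn)) //= /dp_part eqxx big1 ?addr0 // => i ni.
  by case: eqP => // e; case/eqP: ni; apply: val_inj.
rewrite big1 // => -[[|r] rn] _ /=.
  rewrite big1 // => w _; rewrite /dp_part; case: eqP => [/f0->|_]; first by rewrite mul0r.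
  by rewrite mulr0.
case: n rn => // M _; rewrite trace_depth //; case: r => [|r]; last first.
  by rewrite /m' /= Hm // oppr0.
rewrite big1 ?oppr0 // => v _; rewrite /dp_part; case: eqP => [dv|_]; last by rewrite mul0r.
case: (word_split_y v) => [->|[i [u vE]]]; last first.
  by move: dv; rewrite vE depth_cat /depth /= => /eqP; rewrite addn_eq0 andbF.
by rewrite /div_defect /m' /= mul0r addr0 /pdivY rcons_nseq subrr mul0r.
Qed.

Section CyclicSums.
Variables (r M : nat) (g : series).

Lemma eval_of_trace :
  (forall phi, cyclic phi -> \sum_(v <- words M) dp_part r g v * phi (rcons v true) = 0) ->
  forall y, size y = r.+1 -> \sum_(i < r.+1) wval M (dp_part r g) (rot i y) = 0.
Proof.
move=> H y sy; rewrite -[RHS](H (dp_part r.+1 (closed_mval r.+1 y))).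
  rewrite /wval exchange_big; apply: eq_words => v _ /=.
  rewrite -mulr_sumr /dp_part depth_rcons addn1 eqSS; case: eqP => [dv|]; last by rewrite !mul0r.
  congr (_ * _); apply: eq_bigr => i _.
  rewrite -[rcons v _]cats1 mval_cat [X in _ = _ * X]/= mulr1; apply: eq_mval => j jv.
  by rewrite nth_rcons size_rot sy ltnS (leq_trans jv) // dv.
move=> u v; rewrite /dp_part !depth_cat addnC; case: eqP => // duv.
by apply: closed_mval_cyclic => //; rewrite addnC.
Qed.

(** The cyclic sum of values is the value of the sum of [g] over all shifts [rotw], which therefore
    vanishes word by word. Its pairing with [phi] is r+1 times the wanted one, whence the division
    in characteristic 0. *)
Lemma trace_of_eval :
  (forall y, size y = r.+1 -> uniq (0 :: y) ->
     \sum_(i < r.+1) wval M (dp_part r g) (rot i y) = 0) ->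
  forall phi, cyclic phi -> \sum_(v <- words M) dp_part r g v * phi (rcons v true) = 0.
Proof.
move=> H phi cphi.
pose G v := \sum_(i < r.+1) g (iter i rotw v).
have G0 v : size v = M -> depth v = r -> G v = 0.
  move=> sv dv; apply: wval_inj sv dv => y sy uy; rewrite -[RHS](H y sy uy).
  under [RHS]eq_bigr => i _ do rewrite wval_rot // 1?ltnW //.
  rewrite /wval exchange_big; apply: eq_words => w _ /=; rewrite -mulr_suml; congr (_ * _).
  by rewrite /dp_part; case: eqP => // _; rewrite big1.
have rotE i : \sum_(v <- words M) dp_part r (g \o iter i rotw) v * phi (rcons v true) =
    \sum_(v <- words M) dp_part r g v * phi (rcons v true).
  elim: i => [//|i IH]; rewrite -[RHS]IH -[RHS]sum_rotw; apply: eq_words => v _.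
  rewrite -/((_ \o rotw) v) -dp_part_rotw; congr (_ * _).
    by congr (dp_part r _ v); apply: functional_extensionality => w; rewrite /= -iterSr.
  case: (word_split_y v) => [->|[j [u ->]]]; first by rewrite rotw_x.
  by rewrite rotw_y -!cats1 -!catA cphi -[RHS]cphi -!catA.
have : \sum_(i < r.+1) \sum_(v <- words M) dp_part r g v * phi (rcons v true) = 0.
  under eq_bigr => i _ do rewrite -(rotE i).
  rewrite exchange_big big1_seq // => v /andP[_]; rewrite mem_words => /eqP sv /=.
  rewrite -mulr_suml /dp_part; case: (depth v =P r) => [dv|_]; last by rewrite big1 ?mul0r.
  by rewrite -/(G v) G0 // mul0r.
rewrite sumr_const card_ord -mulr_natr => /eqP; rewrite mulf_eq0 Num.Theory.pnatr_eq0 orbF.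
by move/eqP.
Qed.

End CyclicSums.

(** * The partial fraction behind circ-neutrality *)

Definition cycdiff (y : seq rat) : rat :=
  \prod_(i < size y) (nth 0 (rot i y) 0 - nth 0 (rot i y) 1).

Lemma cycdiff_rot y i : (i <= size y)%N -> cycdiff (rot i y) = cycdiff y.
Proof.
elim: i => [|i IH] iy; first by rewrite rot0.
rewrite rotS // -[RHS]IH 1?ltnW //; move: (rot i y) => z {IH iy}.
rewrite /cycdiff size_rot; case szn: (size z) => [|n]; first by rewrite !big_ord0.
rewrite [LHS]big_ord_recr [RHS]big_ord_recl /= mulrC rot0; congr (_ * _).
  by rewrite -rotD ?szn ?addn1 // -{1 2}szn rot_size.
apply: eq_bigr => j _; rewrite rot_rot -rotS //.
by rewrite szn ltnW // ltnS.
Qed.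

Lemma cycdiffE r y : size y = r.+2 -> cycdiff y =
  (\prod_(j < r.+1) (nth 0 y j - nth 0 y j.+1)) * (last 0 y - head 0 y).
Proof.
move=> sy; have nr i j : (i + j < size y)%N -> nth 0 (rot i y) j = nth 0 y (i + j).
  by move=> ij; rewrite /rot nth_cat size_drop nth_drop ltn_subRL ij.
rewrite /cycdiff sy big_ord_recr /=; congr (_ * (_ - _)).
- apply: eq_bigr => j _; rewrite !nr ?addn0 ?addn1 //.
    by rewrite sy ltnS ltn_ord.
  by rewrite sy ltnW // ltnS ltn_ord.
- by rewrite nr ?addn0 ?sy // -nth_last sy.
by rewrite /rot nth_cat size_drop sy subSnn /= nth_take // nth0.
Qed.

(** The denominator of [Bstar] at the differences of 0, y_0, y_1, ...; the signs of 0 - y_0 and of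
    the total 0 - y_last cancel. *)
Definition swap_denom (y : seq rat) : rat :=
  head 0 y * last 0 y * \prod_(j < (size y).-1) (nth 0 y j - nth 0 y j.+1).

(** The power of [x,y] contributes the consecutive differences, and the commutator with x
    contributes the closing factor y_last - y_first. *)
Lemma wval_brXY r y M : size y = r.+2 ->
  wval M (dp_part r.+1 (sbr (brXYpow r.+1) X)) y = (M == (2 * r.+1).+1)%:R * cycdiff y.
Proof.
move=> sy; set q := sbr _ _.
have hq : bihomog (2 * r.+1).+1 r.+1 q.
  have := bihomog_sbr (bihomog_brXYpow (r := r.+1)) (bihomog_mon (u := [:: false])).
  by rewrite addn1 addn0.
have [->|nM] := eqVneq; last first.
  rewrite mul0r /wval big1_seq // => w /andP[_]; rewrite mem_words => /eqP sw.
  rewrite /dp_part; case: eqP => _; last by rewrite mul0r.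
  have [->|/hq [e _]] := eqVneq (q w) 0; first by rewrite mul0r.
  by rewrite -sw e eqxx in nM.
rewrite mul1r (cycdiffE sy).
have -> : dp_part r.+1 q = q.
  apply: functional_extensionality => w; rewrite /dp_part.
  have [->|/hq [_ ->]] := eqVneq (q w) 0; first by rewrite if_same.
  by rewrite eqxx.
have P : wval (2 * r.+1) (brXYpow r.+1) y = \prod_(j < r.+1) (nth 0 y j - nth 0 y j.+1).
  have := @wval_Cprod (nseq r.+1 2) y; rewrite sumn_nseq size_nseq all_nseq orbT => -> //.
  by apply: eq_bigr => j _; rewrite nth_nseq ltn_ord expr1.
have E1 := wval_smul 1 X y (bihomog_brXYpow (r := r.+1)).
have E2 := wval_smul (2 * r.+1) (brXYpow r.+1) y (bihomog_mon (u := [:: false])).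
rewrite addn1 in E1; rewrite add1n in E2; rewrite [LHS]wval_sub E1 E2 drop0 P.
rewrite !(wval_letter false) -[head 0 (drop _ _)]nth0 nth_drop addn0 -nth_last sy /=.
ring.
Qed.

Section SwapSum.
Variables (b : series) (r M : nat).
Hypothesis pb : push_sym b.

(** Setting z_0 = 0 keeps exactly the words beginning with y. *)
Let U y := wval M.+2 (dp_part r.+2 b) (0 :: y).

Let A (y : seq rat) :=
  (\sum_(v <- words M) dp_part r (lquot true (lquot true b)) v * mval v (behead y)) / head 0 y.

Let A' (y : seq rat) :=
  (\sum_(v <- words M) dp_part r (rquot true (lquot true b)) v * mval v y) / last 0 y.

Let UE y : U y = wval M.+1 (dp_part r.+1 (lquot true b)) y.
Proof.
rewrite /U /wval sum_wordsS big1 ?add0r => [|w _]; last by rewrite /= mul0r mulr0.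
by apply: eq_words => w _.
Qed.

Let U_head y : head 0 y != 0 ->
  U y / head 0 y = wval M (dp_part r.+1 (lquot false (lquot true b))) y + A y.
Proof.
move=> y0; rewrite UE /wval sum_wordsS mulrDl; congr (_ + _).
by rewrite mulr_suml; apply: eq_words => w _ /=; rewrite mulrCA mulrC mulKf.
Qed.

Let U_last y : size y = r.+2 -> last 0 y != 0 ->
  U y / last 0 y = wval M (dp_part r.+1 (rquot false (lquot true b))) y + A' y.
Proof.
move=> sy y0; rewrite UE /wval sum_words_rcons mulrDl; congr (_ + _).
  rewrite mulr_suml; apply: eq_words => w _; rewrite /dp_part depth_rcons addn0.
  case: eqP => [dw|_]; last by rewrite !mul0r.
  rewrite -cats1 mval_cat /= mulr1 dw -nth0 nth_drop addn0.
  by move: y0; rewrite -nth_last sy /= => y0; rewrite mulrA mulfK // cats1.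
congr (_ / _); apply: eq_words => w _; rewrite /dp_part depth_rcons addn1 eqSS; congr (_ * _).
by rewrite -cats1 mval_cat /= mulr1.
Qed.

Let A_rot y : size y = r.+2 -> A' (rot 1 y) = A y.
Proof.
case: y => // t y [sy]; rewrite /A /A' rot1_cons last_rcons; congr (_ / _).
apply: eq_words => w _; rewrite /dp_part; case: eqP => [dw|_]; last by rewrite !mul0r.
congr (_ * _).
  by have := pb (true :: w) [::]; rewrite cats1.
by apply: eq_mval => i iw; rewrite nth_rcons sy ltnS (leq_trans iw) // dw.
Qed.

(** Dividing by the first variable leaves a remainder [A] from words beginning with yy, and dividing
    by the last leaves [A'] from words y w y. By push-symmetry [A'] is a rotation of [A], so the
    remainders cancel over a full turn. *)
Lemma sum_swap y (mr : rat) : size y = r.+2 ->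
  (forall i : 'I_r.+2, swap_denom (rot i y) != 0) ->
  \sum_(i < r.+2) (wval M.+2 (dp_part r.+2 b) (0 :: rot i y) / swap_denom (rot i y) +
     (if M.+2 == (2 * r.+2).+1 then mr else 0)) =
  (\sum_(i < r.+2) wval M (dp_part r.+1 (div_defect b mr r.+1)) (rot i y)) / cycdiff y.
Proof.
move=> sy dn.
have wE : (M.+2 == (2 * r.+2).+1) = (M == (2 * r.+1).+1) by rewrite (mulnS 2 r.+1) !eqSS.
have hd (i : 'I_r.+2) : head 0 (rot i y) != 0.
  by have := dn i; rewrite /swap_denom !mulf_eq0 !negb_or => /andP[/andP[]].
have ls (i : 'I_r.+2) : last 0 (rot i y) != 0.
  by have := dn i; rewrite /swap_denom !mulf_eq0 !negb_or => /andP[/andP[]].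
have k0 : cycdiff y != 0.
  rewrite /cycdiff sy; apply/prodf_neq0 => i _.
  have := dn i; rewrite /swap_denom size_rot sy mulf_eq0 negb_or => /andP[_].
  by rewrite big_ord_recl mulf_eq0 negb_or => /andP[].
have dE (i : 'I_r.+2) : (swap_denom (rot i y))^-1 =
    ((head 0 (rot i y))^-1 - (last 0 (rot i y))^-1) / cycdiff y.
  have si : size (rot i y) = r.+2 by rewrite size_rot.
  have ki : cycdiff y = cycdiff (rot i y) by rewrite cycdiff_rot // sy ltnW.
  have := dn i; have := k0; rewrite ki (cycdiffE si) /swap_denom si /=.
  move: (hd i) (ls i); move: (head 0 _) (last 0 _) => p q p0 q0.
  set P := \prod_(_ < _) _; rewrite mulf_eq0 negb_or => /andP[P0 qp] _.
  by field; rewrite P0 qp p0 q0.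
rewrite big_split /=.
under eq_bigr => i _ do rewrite dE mulrA mulrBr U_head ?U_last ?size_rot //.
rewrite -mulr_suml sumrB !big_split /=.
have -> : \sum_(i < r.+2) A' (rot i y) = \sum_(i < r.+2) A (rot i y).
  rewrite -sum_rotS //; apply: eq_bigr => i _.
  by rewrite rotS ?sy // A_rot // size_rot.
rewrite opprD addrACA subrr addr0 -sumrB.
under [in RHS]eq_bigr => i _.
  have -> : wval M (dp_part r.+1 (div_defect b mr r.+1)) (rot i y) =
    wval M (dp_part r.+1 (pdivY b)) (rot i y) +
      mr * wval M (dp_part r.+1 (sbr (brXYpow r.+1) X)) (rot i y).
    rewrite /wval mulr_sumr -big_split; apply: eq_words => w _.
    by rewrite /dp_part /div_defect; case: eqP => _ /=; ring.
  rewrite wval_brXY ?size_rot // cycdiff_rot ?sy 1?ltnW //.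
  over.
rewrite [in RHS]big_split mulrDl; congr (_ / _ + _).
  apply: eq_bigr => i _; rewrite -wval_sub; apply: eq_words => w _.
  by rewrite /dp_part; case: eqP => // _; rewrite subrr.
rewrite !sumr_const card_ord wE.
case: eqP => _ /=; last by rewrite mul0r mulr0 !mul0rn mul0r.
by rewrite mul1r -mulrnAl mulfK.
Qed.

End SwapSum.

(** * Rational functions *)

Local Notation "x %:F" := (tofr x).

Lemma frac_repr (R : idomainType) (f : {fraction R}) :
  f * FracField.tofrac (frac (repr f)).2 = FracField.tofrac (frac (repr f)).1.
Proof.
rewrite -{1}[f]reprK; move: (repr f) => x; unlock FracField.tofrac.
rewrite -[LHS]FracField.pi_mul; apply/eqmodP.
have dx := denom_ratioP x.
rewrite /= FracField.equivfE /FracField.mulf !numden_Ratio ?mulf_neq0 ?oner_neq0 //.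
by rewrite !mulr1 mulrC.
Qed.

Lemma comp_mpoly_inj r (lq : r.-tuple {mpoly rat[r]}) :
  (forall v : 'I_r -> rat, exists v', (fun i => (tnth lq i).@[v']) =1 v) ->
  forall p : {mpoly rat[r]}, p \mPo lq = 0 -> p = 0.
Proof.
move=> surj p p0; apply: mpoly_eq0 => v; have [v' vE] := surj v.
by rewrite -(meval_eq _ vE) -comp_mpoly_meval p0 meval0.
Qed.

(** [fsub] works on a chosen representative; the result is independent of it once the substitution
    kills no denominator, which surjectivity on points ensures. *)
Lemma fsubE r (lq : r.-tuple {mpoly rat[r]}) (p q : {mpoly rat[r]}) :
  (forall v : 'I_r -> rat, exists v', (fun i => (tnth lq i).@[v']) =1 v) ->
  q != 0 -> fsub lq (p%:F / q%:F) = (p \mPo lq)%:F / (q \mPo lq)%:F.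
Proof.
move=> /comp_mpoly_inj inj q0; rewrite /fsub.
set f := p%:F / q%:F; have := frac_repr f.
have := denom_ratioP (repr f).
move: (frac (repr f)) => [n d] /= d0 e.
have c0 s : s != 0 -> s \mPo lq != 0 by apply: contra => /eqP /inj ->.
have qF : q%:F != 0 by rewrite tofrac_eq0.
have nq : n * q = p * d.
  apply/eqP; rewrite -tofrac_eq !tofracM -e /f -/(tofr _) -/(tofr _) -/(tofr _).
  by rewrite mulrAC divfK.
apply/eqP; rewrite eqr_div ?tofrac_eq0 ?c0 //.
by rewrite -!tofracM -!rmorphM /= nq.
Qed.

Lemma sum_div_common (F : fieldType) r (n d : 'I_r -> F) : (forall i, d i != 0) ->
  (\sum_(i < r) n i / d i) * \prod_(i < r) d i =
  \sum_(i < r) n i * \prod_(j < r | j != i) d j.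
Proof.
move=> d0; rewrite mulr_suml; apply: eq_bigr => i _.
by rewrite (bigD1 i) //= mulrA divfK.
Qed.

(** For the converse, the cleared numerator times the product of the denominators vanishes at every
    point, the bad points being absorbed by that product. *)
Lemma frac_sum_eq0 r k (n d : 'I_r -> {mpoly rat[k]}) : (forall i, d i != 0) ->
  \sum_(i < r) (n i)%:F / (d i)%:F = 0 <->
  (forall v, (forall i, (d i).@[v] != 0) -> \sum_(i < r) (n i).@[v] / (d i).@[v] = 0).
Proof.
move=> d0; pose P := \sum_(i < r) n i * \prod_(j < r | j != i) d j.
have Pv v : P.@[v] = \sum_(i < r) (n i).@[v] * \prod_(j < r | j != i) (d j).@[v].
  by rewrite raddf_sum; apply: eq_bigr => i _; rewrite /= mevalM rmorph_prod.
have dF i : (d i)%:F != 0 by rewrite tofrac_eq0.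
have PF : P%:F = (\sum_(i < r) (n i)%:F / (d i)%:F) * \prod_(i < r) (d i)%:F.
  rewrite sum_div_common // /tofr raddf_sum; apply: eq_bigr => i _.
  by rewrite /= tofracM rmorph_prod.
split=> [s0 v dv|H].
  have P0 : P = 0 by apply/eqP; rewrite -tofrac_eq0 -/(tofr P) PF s0 mul0r.
  have := Pv v; rewrite P0 meval0 -sum_div_common // => /esym/eqP.
  rewrite mulf_eq0 => /orP[/eqP //|]; rewrite prodf_seq_eq0 => /hasP[i _].
  by rewrite (negbTE (dv i)) andbF.
have pd : \prod_(i < r) d i != 0 by apply/prodf_neq0 => i _.
have P0 : P = 0.
  apply/eqP; have : P * \prod_(i < r) d i == 0.
    apply/eqP; apply: mpoly_eq0 => v; rewrite mevalM rmorph_prod /=.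
    have [/forallP dv|/forallPn[i]] := boolP [forall i, (d i).@[v] != 0].
      by rewrite Pv -sum_div_common // H // !mul0r.
    by rewrite negbK => /eqP di; rewrite (bigD1 i) //= di mul0r mulr0.
  by rewrite mulf_eq0 (negbTE pd) orbF.
have := PF; rewrite P0 /tofr tofrac0 => /esym/eqP; rewrite mulf_eq0 => /orP[/eqP //|].
by move/prodf_eq0 => [i _]; rewrite -/(tofr _) (negbTE (dF i)).
Qed.

Definition point r (z : seq rat) (i : 'I_r) : rat := nth 0 z i.

Lemma Xv_point r z j : (j < r)%N -> (Xv r j).@[point (r := r) z] = nth 0 z j.
Proof.
move=> jr; rewrite /Xv (nth_map (Ordinal jr)) ?size_enum_ord // mevalXU /point.
by rewrite nth_enum_ord.
Qed.

Lemma pointE r (v : 'I_r -> rat) : exists z, size z = r /\ point z =1 v.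
Proof.
exists [seq v i | i <- enum 'I_r]; rewrite size_map size_enum_ord; split=> // i.
by rewrite /point (nth_map i) ?size_enum_ord // nth_ord_enum.
Qed.

Definition diffs r (z : seq rat) (j : 'I_r) : rat := nth 0 z j - nth 0 z j.+1.

Lemma diffs_surj r (v : 'I_r -> rat) : exists y, size y = r /\ diffs (0 :: y) =1 v.
Proof.
have [z [sz zE]] := pointE v.
exists (mkseq (fun i => - \sum_(k < i.+1) nth 0 z k) r); rewrite size_mkseq; split=> // j.
rewrite -zE /point /diffs [nth 0 (_ :: _) j.+1]/= nth_mkseq // big_ord_recr /=.
case: j => [[|j] jr] /=; first by rewrite big_ord0; ring.
by rewrite nth_mkseq 1?ltnW //; ring.
Qed.

Lemma sum_diffs r z : \sum_(j < r) diffs z j = nth 0 z 0 - nth 0 z r.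
Proof.
elim: r => [|r IH]; first by rewrite big_ord0 subrr.
by rewrite big_ord_recr /= [X in X + _](eq_bigr (@diffs r z)) // IH /diffs /=; ring.
Qed.

Definition denom r : {mpoly rat[r]} := (\prod_(j < r) 'X_j) * (\sum_(j < r) 'X_j).

Lemma denom_diffs r z : (denom r).@[diffs (r := r) z] =
  (\prod_(j < r) (nth 0 z j - nth 0 z j.+1)) * (nth 0 z 0 - nth 0 z r).
Proof.
rewrite mevalM rmorph_prod raddf_sum -sum_diffs; congr (_ * _);
  by apply: eq_bigr => j _; rewrite /= mevalXU.
Qed.

Lemma denom_neq0 r : (0 < r)%N -> denom r != 0.
Proof.
move=> r0; apply/eqP => /(congr1 (meval (fun _ => 1))).
rewrite meval0 mevalM rmorph_prod raddf_sum /=.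
under eq_bigr => j _ do rewrite mevalXU.
under [X in _ * X]eq_bigr => j _ do rewrite mevalXU.
rewrite big1_eq mul1r sumr_const card_ord => /eqP.
by rewrite Num.Theory.pnatr_eq0 eqn0Ngt r0.
Qed.

(** In the z variables u_0 = z_r - z_0 is the difference closing the circle, so push is a backward
    rotation. *)
Lemma push_sub_diffs r z : size z = r.+2 ->
  (fun j => (tnth (push_sub r.+1) j).@[diffs (r := r.+1) z]) =1 diffs (rotr 1 z).
Proof.
case/lastP: z => // z t; rewrite size_rcons => -[sz] j.
rewrite rotr1_rcons tnth_mktuple; case: j => [[|j] jr] /=.
  rewrite mevalN (raddf_sum (meval _)) /=; under eq_bigr => k _ do rewrite mevalXU.
  by rewrite sum_diffs /diffs /= !nth_rcons sz ltnn eqxx /=; ring.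
have jr' : (j < r.+1)%N by apply: ltnW.
rewrite /Xv (nth_map ord0) ?size_enum_ord // mevalXU /diffs /= nth_enum_ord //.
by rewrite !nth_rcons sz jr' jr.
Qed.

(** The denominator is - u_0 u_1 ... u_r. Push-invariance of [Bstar] therefore amounts to that of
    its numerator. *)
Lemma denom_push r : denom r.+1 \mPo push_sub r.+1 = denom r.+1.
Proof.
apply/eqP; rewrite -subr_eq0; apply/eqP; apply: mpoly_eq0 => v.
have [y [sy vE]] := diffs_surj v; have sz : size (0 :: y) = r.+2 by rewrite /= sy.
move: (0 :: y) sz vE => {y sy} z sz vE.
have e : (fun i => (tnth (push_sub r.+1) i).@[v]) =1 diffs (rotr 1 z).
  by move=> i; rewrite -(push_sub_diffs sz i); apply: meval_eq => l; rewrite vE.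
rewrite mevalB comp_mpoly_meval (meval_eq _ e) -[X in _ - X](meval_eq _ vE) !denom_diffs.
move: sz {e vE}; case/lastP: z => // z t; rewrite size_rcons rotr1_rcons => -[sz].
rewrite big_ord_recl [X in _ - X * _]big_ord_recr /=.
rewrite [X in _ - X * _ * _](eq_bigr (fun j : 'I_r => nth 0 z j - nth 0 z j.+1)); last first.
  by move=> j _; rewrite !nth_rcons sz ltnS (ltnW (ltn_ord j)) ltnS ltn_ord.
by rewrite !nth_rcons sz ltnSn ltnn eqxx ltn0Sn; ring.
Qed.

Lemma push_sub_surj r (v : 'I_r.+1 -> rat) :
  exists v', (fun i => (tnth (push_sub r.+1) i).@[v']) =1 v.
Proof.
have [y [sy vE]] := diffs_surj v; exists (diffs (rot 1 (0 :: y))) => i.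
by rewrite push_sub_diffs ?size_rot /= ?sy // rotK vE.
Qed.

Lemma BstarE k r n : Bstar k r n = (Bpol k r n)%:F / (denom r)%:F.
Proof. by []. Qed.

Lemma push_invariantP b k : Cexp b k -> push_invariant k <-> push_sym b.
Proof.
move=> bk; rewrite push_sym_wval.
have W r n z : (Bpol k r n).@[diffs (r := r) z] = wval n (dp_part r b) z.
  exact: Bpol_wval.
have pushE r n : fsub (push_sub r.+1) (Bstar k r.+1 n) = Bstar k r.+1 n <->
    Bpol k r.+1 n \mPo push_sub r.+1 = Bpol k r.+1 n.
  have dF : (denom r.+1)%:F != 0 by rewrite tofrac_eq0 denom_neq0.
  rewrite BstarE fsubE ?denom_neq0 //; last exact: push_sub_surj.
  rewrite denom_push; split=> [/(mulIf (invr_neq0 dF))/eqP|-> //].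
  by rewrite tofrac_eq => /eqP.
split=> H.
  move=> [|r] n z sz; first by case: z sz => [|t []].
  have := H r.+1 n isT; move/pushE => /(congr1 (meval (diffs (rot 1 z)))).
  rewrite comp_mpoly_meval W => <-; rewrite -[in RHS](rotK 1 z) -W.
  by apply: meval_eq => i; rewrite push_sub_diffs // size_rot.
move=> [|r] n // _; apply/pushE/eqP; rewrite -subr_eq0; apply/eqP.
apply: mpoly_eq0 => v; have [y [sy vE]] := diffs_surj v.
have sz : size (0 :: y) = r.+2 by rewrite /= sy.
rewrite mevalB comp_mpoly_meval -[X in _ - X](meval_eq _ vE) W.
have e : (fun i => (tnth (push_sub r.+1) i).@[v]) =1 diffs (rotr 1 (0 :: y)).
  by move=> i; rewrite -(push_sub_diffs sz i); apply: meval_eq => l; rewrite vE.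
rewrite (meval_eq _ e) W -[X in _ - wval _ _ X](rotrK 1) H ?subrr //.
by rewrite size_rotr.
Qed.

Lemma rot_sub_point r i z : size z = r.+1 -> (i <= r)%N ->
  (fun j => (tnth (rot_sub r.+1 i) j).@[point (r := r.+1) z]) =1 point (rot i z).
Proof.
move=> sz ir j; rewrite tnth_mktuple Xv_point ?ltn_pmod // /point /rot nth_cat.
rewrite size_drop sz nth_drop ltn_subRL; case: ltnP => ij; first by rewrite modn_small.
have jr := ltn_ord j; rewrite -(subnK ij) modnDr modn_small; last by lia.
by rewrite nth_take; [congr (nth 0 z _)|]; lia.
Qed.

Lemma rot_sub_surj r i (v : 'I_r.+1 -> rat) : (i <= r)%N ->
  exists v', (fun j => (tnth (rot_sub r.+1 i) j).@[v']) =1 v.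
Proof.
move=> ir; have [z [sz vE]] := pointE v; exists (point (rotr i z)) => j.
by rewrite rot_sub_point ?size_rotr // rotrK vE.
Qed.

(* In the variables [y_j = - v_(r-j)] the substitution [swap] becomes the passage to
   consecutive differences of [0, y_0, ..., y_(r-1)]. *)
Definition revopp (y : seq rat) := rev (map -%R y).

Lemma nth_revopp y i : (i < size y)%N -> nth 0 (revopp y) i = - nth 0 y (size y - i.+1).
Proof.
move=> iy; rewrite /revopp nth_rev ?size_map // (nth_map 0) //.
by rewrite ltn_subrL /= (leq_ltn_trans _ iy).
Qed.

Lemma revoppK : involutive revopp.
Proof.
move=> y; rewrite /revopp map_rev revK -map_comp -[RHS]map_id.
by apply: eq_map => t /=; rewrite opprK.
Qed.

Lemma size_revopp y : size (revopp y) = size y.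
Proof. by rewrite size_rev size_map. Qed.

Lemma rot_revopp i y : rot i (revopp y) = revopp (rotr i y).
Proof. by rewrite /revopp map_rotr -rev_rotr. Qed.

Lemma swap_sub_revopp r y : size y = r.+1 ->
  (fun j => (tnth (swap_sub r.+1) j).@[point (r := r.+1) (revopp y)]) =1 diffs (0 :: y).
Proof.
move=> sy j; rewrite tnth_mktuple; case: j => [[|j] jr] /=.
  rewrite Xv_point // nth_revopp sy // subnn /diffs /=; ring.
rewrite mevalB !Xv_point; try lia.
rewrite !nth_revopp ?sy; try lia.
have -> : (r.+1 - (r.+1 - j.+1).-1.+1)%N = j.+1 by lia.
have -> : (r.+1 - (r.+1 - j.+1).+1)%N = j by lia.
by rewrite /diffs /=; ring.
Qed.

Lemma swap_sub_surj r (v : 'I_r.+1 -> rat) :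
  exists v', (fun j => (tnth (swap_sub r.+1) j).@[v']) =1 v.
Proof.
have [y [sy vE]] := diffs_surj v; exists (point (revopp y)) => j.
by rewrite swap_sub_revopp // vE.
Qed.

Lemma swap_denomE r y : size y = r.+1 ->
  (denom r.+1).@[diffs (r := r.+1) (0 :: y)] = swap_denom y.
Proof.
move=> sy; rewrite denom_diffs /swap_denom sy big_ord_recl /= -nth0 -nth_last sy /=.
ring.
Qed.

Lemma rotr_rot r (i : 'I_r.+1) (y : seq rat) : size y = r.+1 ->
  rotr i y = rot (- i)%R y.
Proof.
move=> sy; rewrite /rotr sy /=; case: i => [[|i] ir] /=; last by rewrite modn_small //; lia.
by rewrite subn0 modnn rot0 -sy rot_size.
Qed.

(** [revopp] reverses the direction of rotation; as all rotations are summed, reindexing by the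
    opposite in Z/(r+1) undoes this. *)
Lemma circ_frac b k r n (c : rat) : Cexp b k ->
  (\sum_(i < r.+1) fsub (rot_sub r.+1 i)
     (fsub (swap_sub r.+1) (Bstar k r.+1 n) + (c%:MP)%:F) = 0) <->
  (forall y, size y = r.+1 -> (forall i : 'I_r.+1, swap_denom (rot i y) != 0) ->
    \sum_(i < r.+1) (wval n (dp_part r.+1 b) (0 :: rot i y) / swap_denom (rot i y) + c) = 0).
Proof.
move=> bk; pose N := Bpol k r.+1 n \mPo swap_sub r.+1.
pose Q := denom r.+1 \mPo swap_sub r.+1.
have Q0 : Q != 0.
  by apply: contraNneq (denom_neq0 (ltn0Sn r)) => /(comp_mpoly_inj (@swap_sub_surj r)) ->.
pose m i := (N + c%:MP * Q) \mPo rot_sub r.+1 i.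
pose d i := Q \mPo rot_sub r.+1 i.
have d0 (i : 'I_r.+1) : d i != 0.
  have ir : (i <= r)%N by rewrite -ltnS.
  by apply: contraNneq Q0 => /(comp_mpoly_inj (fun v => rot_sub_surj v ir)) ->.
rewrite [X in X = 0 <-> _](_ : _ = \sum_(i < r.+1) (m i)%:F / (d i)%:F); last first.
  apply: eq_bigr => i _; have ir : (i <= r)%N by rewrite -ltnS.
  rewrite BstarE fsubE ?denom_neq0 //; last exact: swap_sub_surj.
  rewrite (_ : _ + _ = (N + c%:MP * Q)%:F / Q%:F).
    by rewrite fsubE // => v; apply: rot_sub_surj.
  rewrite /tofr tofracD tofracM mulrDl mulfK //.
  by rewrite tofrac_eq0.
have mv i y : size y = r.+1 -> (i <= r)%N -> (m i).@[point (revopp y)] =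
    wval n (dp_part r.+1 b) (0 :: rotr i y) + c * swap_denom (rotr i y).
  move=> sy ir; rewrite comp_mpoly_meval (meval_eq _ (rot_sub_point _ ir)) ?size_revopp //.
  have sr : size (rotr i y) = r.+1 by rewrite size_rotr.
  rewrite rot_revopp mevalD mevalM mevalC !comp_mpoly_meval !(meval_eq _ (swap_sub_revopp sr)).
  by rewrite swap_denomE // (Bpol_wval (z := 0 :: rotr i y) n bk).
have dv i y : size y = r.+1 -> (i <= r)%N -> (d i).@[point (revopp y)] = swap_denom (rotr i y).
  move=> sy ir; rewrite comp_mpoly_meval (meval_eq _ (rot_sub_point _ ir)) ?size_revopp //.
  have sr : size (rotr i y) = r.+1 by rewrite size_rotr.
  by rewrite rot_revopp comp_mpoly_meval (meval_eq _ (swap_sub_revopp sr)) swap_denomE.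
have term y : size y = r.+1 -> (forall i : 'I_r.+1, swap_denom (rot i y) != 0) ->
   \sum_(i < r.+1) (m i).@[point (revopp y)] / (d i).@[point (revopp y)] =
   \sum_(i < r.+1) (wval n (dp_part r.+1 b) (0 :: rot i y) / swap_denom (rot i y) + c).
  move=> sy dn; rewrite [RHS](reindex_inj (@oppr_inj _)); apply: eq_bigr => i _.
  have ir : (i <= r)%N by rewrite -ltnS.
  by rewrite mv // dv // -rotr_rot // mulrDl mulfK // rotr_rot.
rewrite frac_sum_eq0 //; split=> H.
  move=> y sy dn; rewrite -term //; apply: H => i.
  by rewrite dv ?rotr_rot // -ltnS.
move=> v; have [z [sz vE]] := pointE v.
pose y := revopp z; have sy : size y = r.+1 by rewrite size_revopp.
have vE' : v =1 point (revopp y) by move=> i; rewrite revoppK vE.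
under eq_bigr => i _ do rewrite !(meval_eq _ vE').
move=> dn; have dn' (i : 'I_r.+1) : swap_denom (rot i y) != 0.
  have := dn (- i)%R; rewrite (meval_eq _ vE') dv ?rotr_rot // ?opprK //.
  by rewrite -ltnS.
by rewrite term // H.
Qed.

Lemma div_defect_trace0 b k : no_depth0 b -> push_sym b -> Cexp b k ->
  swap_circ_const k <-> div_cond b.
Proof.
move=> b0 pb bk; rewrite div_condP //.
have cst r n (m : nat -> rat) :
    (if n == (2 * r).+1 then (m r)%:MP else 0) =
    (if n == (2 * r).+1 then m r else 0)%:MP :> {mpoly rat[r]}.
  by case: eqP.
split=> [[m Hm]|[m Hm]]; exists m.
  move=> [|r] M // _; apply: trace_of_eval => y sy uy.
  have := Hm r.+2 M.+2 isT; rewrite cst (circ_frac _ _ _ bk) => /(_ y sy) H.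
  have dn (i : 'I_r.+2) : swap_denom (rot i y) != 0.
    have ui : uniq (0 :: rot i y) by rewrite cons_uniq mem_rot rot_uniq.
    have si : size (rot i y) = r.+2 by rewrite size_rot.
    move: (rot i y) si ui => z sz /= /andP[z0 uz].
    have nz j : (j < r.+2)%N -> nth 0 z j != 0.
      by move=> jr; apply: contraNneq z0 => <-; rewrite mem_nth ?sz.
    rewrite /swap_denom -nth0 -nth_last sz !mulf_neq0 ?nz //.
    apply/prodf_neq0 => j _; have jr : (j < r.+1)%N := ltn_ord j.
    by rewrite subr_eq0 nth_uniq ?sz // ?neq_ltn ?ltnSn // ltnW.
  have := H dn; rewrite sum_swap // => /eqP; rewrite mulf_eq0 invr_eq0 => /orP[/eqP //|].
  rewrite /cycdiff sy => /prodf_eq0 [i _].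
  have := dn i; rewrite /swap_denom size_rot sy mulf_eq0 negb_or => /andP[_].
  by rewrite big_ord_recl mulf_eq0 negb_or => /andP[/negbTE->].
move=> [|[|r]] n // _; rewrite cst (circ_frac _ _ _ bk) => y sy dn.
(* Weights 0 and 1 contain no word of depth at least 2 and differ from 2r+1 for the depths at hand,
   so each summand is zero. *)
case: n => [|[|M]].
- rewrite big1 // => i _; by rewrite /wval sum_words0 /dp_part /= !mul0r addr0.
- rewrite big1 // => i _; rewrite mulnS /= addr0 /wval big1_seq ?mul0r // => w /andP[_].
  rewrite mem_words => /eqP sw; rewrite /dp_part; case: eqP => [dw|_]; last by rewrite mul0r.
  by have := count_size id w; rewrite -/(depth w) dw sw.
rewrite sum_swap // (eval_of_trace (Hm r.+1 M isT)) ?mul0r //.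
Qed.

(** * Expansions in products of the C_i *)

Definition comb (l : seq (rat * seq nat)) : series :=
  fun w => \sum_(t <- l) t.1 * Cprod t.2 w.

Lemma Cprod_cat s t : Cprod (s ++ t) = smul (Cprod s) (Cprod t).
Proof.
elim: s => [|i s IH]; first by rewrite smul1l.
by rewrite /= -/(Cprod _) IH smulA.
Qed.

Lemma comb_smul l l' : smul (comb l) (comb l') =
  comb [seq (t.1 * u.1, t.2 ++ u.2) | t <- l, u <- l'].
Proof.
apply: functional_extensionality => w; rewrite /comb big_allpairs_dep /smul.
transitivity (\sum_(i < (size w).+1) \sum_(t <- l) \sum_(u <- l')
    t.1 * u.1 * (Cprod t.2 (take i w) * Cprod u.2 (drop i w))).
  apply: eq_bigr => i _; rewrite mulr_suml; apply: eq_bigr => t _.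
  by rewrite mulr_sumr; apply: eq_bigr => u _; rewrite mulrACA.
rewrite exchange_big; apply: eq_bigr => t _; rewrite exchange_big; apply: eq_bigr => u _ /=.
by rewrite -mulr_sumr Cprod_cat.
Qed.

Lemma comb_scale c l : sscale c (comb l) = comb [seq (c * t.1, t.2) | t <- l].
Proof.
apply: functional_extensionality => w; rewrite /comb big_map /sscale mulr_sumr.
by apply: eq_bigr => t _; rewrite mulrA.
Qed.

Lemma comb_cat l l' : sadd (comb l) (comb l') = comb (l ++ l').
Proof. by apply: functional_extensionality => w; rewrite /comb big_cat. Qed.

Definition pos_comb (l : seq (rat * seq nat)) :=
  all (fun t => all (fun i => 0 < i)%N t.2) l.

Lemma lie_span_comb p : lie_span isC p -> exists2 l, pos_comb l & p = comb l.
Proof.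
have cm l l' : pos_comb l -> pos_comb l' ->
    pos_comb [seq (t.1 * u.1, t.2 ++ u.2) | t <- l, u <- l'].
  move=> /allP pl /allP pl'; apply/allP => _ /allpairsP[[t u] [tl ul ->]] /=.
  by rewrite all_cat (pl _ tl) (pl' _ ul).
have cs c l : pos_comb l -> pos_comb [seq (c * t.1, t.2) | t <- l].
  by rewrite /pos_comb all_map.
elim=> [s [i i0 ->]||f g _ [l pl ->] _ [l' pl' ->]|c f _ [l pl ->]|f g _ [l pl ->] _ [l' pl' ->]].
- exists [:: (1, [:: i])]; first by rewrite /pos_comb /= i0.
  by apply: functional_extensionality => w; rewrite /comb big_seq1 mul1r /= smul1r.
- by exists [::] => //; apply: functional_extensionality => w; rewrite /comb big_nil.
- by exists (l ++ l'); rewrite ?comb_cat // /pos_comb all_cat; apply/andP.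
- by exists [seq (c * t.1, t.2) | t <- l]; rewrite ?comb_scale ?cs.
rewrite sbr_def !comb_smul comb_scale comb_cat; eexists; last by [].
by rewrite /pos_comb all_cat; apply/andP; split; [exact: cm|apply: cs; exact: cm].
Qed.

Lemma lieC_Cexp b : lieC b -> exists k, Cexp b k.
Proof.
move=> Cb; have exl n : exists l, pos_comb l /\ forall w, wt_part n b w = comb l w.
  have [p [/lie_span_comb [l pl ->] bp]] := Cb n; by exists l.
pose L n := proj1_sig (constructive_indefinite_description _ (exl n)).
have Lpos n : pos_comb (L n) by case: (proj2_sig (constructive_indefinite_description _ (exl n))).
have LE n w : wt_part n b w = comb (L n) w.
  by case: (proj2_sig (constructive_indefinite_description _ (exl n))).
(* The coefficient of a composition is collected from the combination chosen for its own weight;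
   bihomogeneity of [Cprod] then sorts the terms by depth. *)
exists (fun s => \sum_(t <- L (sumn s) | t.2 == s) t.1) => r n w.
transitivity (if (depth w == r) && (size w == n) then comb (L n) w else 0).
  by rewrite -LE /wt_part /dp_part; case: (size w == n); case: (depth w == r).
transitivity (\sum_(s : r.-tuple 'I_n.+1 | is_comp s) \sum_(t <- L n)
    (if t.2 == map val s then t.1 * Cprod t.2 w else 0)); last first.
  apply: eq_bigr => s /is_compP [_ ->]; rewrite -big_mkcond mulr_suml.
  by apply: eq_bigr => t /eqP ->.
rewrite exchange_big /=.
transitivity (\sum_(t <- L n) (if (depth w == r) && (size w == n) then t.1 * Cprod t.2 w else 0)).
  by case: ifP => // _; rewrite big1.
apply: eq_big_seq => t /(allP (Lpos n)) t0; rewrite -big_mkcondr.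
have [C0|Cw] := eqVneq (Cprod t.2 w) 0.
  by rewrite C0 mulr0 if_same big1.
have [sw dw] := bihomog_Cprod t0 Cw; rewrite sw dw.
case: andP => [[/eqP st /eqP nt]|nt]; last first.
  rewrite big1 // => s /andP[/is_compP [_ ss] /eqP e]; case: nt.
  by rewrite e ss size_map size_tuple !eqxx.
have tn : all (fun i => i < n.+1)%N t.2.
  apply/allP => i it; rewrite ltnS -nt sumnE (big_rem i) //= leq_addr //.
have ss : size [seq inord i : 'I_n.+1 | i <- t.2] == r by rewrite size_map st.
have vs : map val (Tuple ss) = t.2.
  rewrite /= -map_comp -[RHS]map_id; apply/eq_in_map => i /(allP tn) /=.
  exact: inordK.
rewrite (bigD1 (Tuple ss)) /=; last first.
  by rewrite /is_comp -(all_map val (fun i => 0 < i)%N) vs t0 nt !eqxx.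
rewrite big1 ?addr0 // => s /andP[/andP[_ /eqP e] ns]; case/eqP: ns.
by apply: val_inj; apply: (inj_map val_inj); rewrite -[LHS]e -[LHS]vs.
Qed.

(** * Linearity and bigrading of krv_ell *)

Lemma krv_ellP b : krv_ell b <-> krvw b.
Proof.
split=> [[Cb [k [bk /(push_invariantP bk) pb cb]]]|[Cb pb db]].
  by split=> //; apply/(div_defect_trace0 (lieC_no_depth0 Cb) pb bk).
split=> //; have [k bk] := lieC_Cexp Cb; exists k; split=> //.
  exact/(push_invariantP bk).
exact/(div_defect_trace0 (lieC_no_depth0 Cb) pb bk).
Qed.

Lemma krvw_linear c b b' : krvw b -> krvw b' -> krvw (sadd (sscale c b) b').
Proof.
move=> [/lieCP[pb bx] sb [m Tm]] [/lieCP[pb' bx'] sb' [m' Tm']]; split.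
- apply/lieCP; split; first by apply: primitiveD => //; apply: primitiveZ.
  by rewrite /sadd /sscale bx bx' mulr0 addr0.
- by move=> u v; rewrite /sadd /sscale sb sb'.
exists (fun r => c * m r + m' r).
rewrite [X in trace0 X](_ : _ = sadd (sscale c (sadd (pdiv b) (sscale (-1) (brXYser m))))
    (sadd (pdiv b') (sscale (-1) (brXYser m')))).
  by apply: trace0D => //; apply: trace0Z.
by apply: functional_extensionality => w; rewrite /sadd /sscale /pdiv /brXYser; ring.
Qed.

(** Unshuffling preserves total depth, so projecting [f] to depth [r] amounts to restricting the
    test functional to pairs of total depth [r]. *)
Lemma primitive_wt_dp n r f : primitive f -> primitive (wt_part n (dp_part r f)).
Proof.
move=> pf N H; have [->|nN] := eqVneq N n; last first.
  have z (G : word -> rat) : \sum_(w <- words N) wt_part n (dp_part r f) w * G w = 0.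
    rewrite big1_seq // => w /andP[_]; rewrite mem_words => /eqP sw.
    by rewrite /wt_part sw (negbTE nN) mul0r.
  by rewrite !z.
pose H' u v := (depth u + depth v == r)%N%:R * H u v.
transitivity (\sum_(w <- words n) f w * unshuffle w H').
  apply: eq_words => w sw; rewrite /wt_part /dp_part sw eqxx.
  rewrite (@eq_unshuffle _ H' (fun u v => (depth w == r)%:R * H u v)) ?unshuffleZ.
    by case: eqP => _ /=; ring.
  by move=> u v _ duv; rewrite /H' -duv.
rewrite pf; apply: eq_words => w sw; rewrite /wt_part /dp_part sw eqxx /H'.
rewrite -(depth_cat w [::]) -(depth_cat [::] w) cats0.
by case: eqP => _ /=; ring.
Qed.

Lemma krvw_bigraded n r b : krvw b -> krvw (wt_part n (dp_part r b)).
Proof.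
move=> [/lieCP[pb bx] sb [m Tm]]; split.
- apply/lieCP; split; first exact: primitive_wt_dp.
  by rewrite /wt_part /dp_part bx !if_same.
- move=> u v; have es : size (u ++ true :: v) = size (v ++ true :: u).
    by rewrite !size_cat /= !addnS addnC.
  have ed : depth (u ++ true :: v) = depth (v ++ true :: u).
    by rewrite !depth_cat /depth /=; lia.
  by rewrite /wt_part /dp_part sb es ed.
(* [pdiv] shortens words by one letter, so the weight-n part of [b] meets [x,y]^r, of length 2r,
   only if n = 2r+1. *)
exists (fun r' => if (r' == r) && (n == (2 * r).+1) then m r else 0) => phi cphi N.
transitivity ((N.+1 == n)%:R * \sum_(w <- words N)
    sadd (pdiv b) (sscale (-1) (brXYser m)) w * dp_part r phi w); last first.
  by rewrite Tm ?mulr0 //; apply: cyclic_depth.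
rewrite mulr_sumr; apply: eq_words => w sw.
rewrite /sadd /sscale !brXYser_depth /pdiv /wt_part /dp_part size_rcons depth_rcons addn0 /= sw.
rewrite -/(depth w); have [->|_] := eqVneq (depth w) r; last first.
  by rewrite /= !mul0r !mulr0; case: ifP => _; ring.
have [->|/bihomog_brXYpow [e _]] := eqVneq (brXYpow r w) 0.
  by case: eqP => _ /=; ring.
by rewrite /= [n == _]eq_sym -e sw; case: eqP => _ /=; ring.
Qed.


Theorem theorem5 :
  (* (i) krv_ell is bigraded for weight and depth *)
  (forall b, krv_ell b -> forall n r, krv_ell (wt_part n (dp_part r b))) /\
  (* (ii) existence and uniqueness of the partner *)
  (forall b, krv_ell b ->
     exists a, [/\ lieC a, in_oder2 b a &
       forall a', lieC a' -> in_oder2 b a' -> forall w, a' w = a w]) /\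
  (* (iii) krv_ell is a subspace, and the image of b |-> D_{b,a} is closed
     under the commutator of derivations: [D_{b,a}, D_{b',a'}] = D_{c,a''}
     with c = <b,b'> = D_{b,a}(b') - D_{b',a'}(b) in krv_ell *)
  (forall (c : rat) b b', krv_ell b -> krv_ell b' ->
     krv_ell (sadd (sscale c b) b')) /\
  (forall b a b' a',
     krv_ell b -> lieC a -> in_oder2 b a ->
     krv_ell b' -> lieC a' -> in_oder2 b' a' ->
     let c : series := fun w => der b a b' w - der b' a' b w in
     krv_ell c /\
     exists a'', [/\ lieC a'', in_oder2 c a'' &
       forall f, lie2 f -> forall w,
         der b a (der b' a' f) w - der b' a' (der b a f) w = der c a'' f w]).
Proof.
split; first by move=> b /krv_ellP kb n r; apply/krv_ellP; apply: krvw_bigraded.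
split.
  move=> b /krv_ellP [Cb sb _]; exists (partner b).
  have Ca := lieC_partner Cb sb; have rel := partner_rel sb.
  have /lieCP[pb bx] := Cb; have /lieCP[pa ax] := Ca.
  split=> // [|a' Ca' [_ _ _ _ rel'] w]; first by split=> //; apply/lie2P.
  by rewrite (partner_uniq (lieC_no_depth0 Ca) (lieC_no_depth0 Ca') rel rel').
split; first by move=> c b b' /krv_ellP kb /krv_ellP kb'; apply/krv_ellP; apply: krvw_linear.
move=> b a b' a' /krv_ellP kb Ca [_ _ _ _ rel] /krv_ellP kb' Ca' [_ _ _ _ rel'] c.
have cE : c = sadd (der b a b') (sscale (-1) (der b' a' b)).
  by apply: functional_extensionality => w; rewrite /c /sadd /sscale mulN1r.
have [kc Cd relc] := krvw_bracket kb Ca rel kb' Ca' rel'.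
rewrite cE; split; first exact/krv_ellP.
exists (sadd (der b a a') (sscale (-1) (der b' a' a))).
have [Cc _ _] := kc; have /lieCP[pc cx] := Cc; have /lieCP[pd dx] := Cd.
have [/lieCP[pb _] _ _] := kb; have [/lieCP[pb' _] _ _] := kb'.
have /lieCP[pa _] := Ca; have /lieCP[pa' _] := Ca'.
split=> //; first by split=> //; apply/lie2P.
by move=> f lf w; apply: der_comm.
Qed.
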